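(* Let $(c_n)_{n=1}^\infty$ be a sequence of real numbers with $c_n\ge 1$ for every $n\in\mathbb N$ and with subexponential growth, i.e. $\frac{\log c_n}{n}\to 0$ as $n\to\infty$. Then there exists a sequence $\gamma=(\gamma_s)_{s=1}^\infty$ with $0<\gamma_s<1/4$ for all $s\in\mathbb N$ such that the associated set $K(\gamma)\subset[0,1]$ is non-polar and $$W_{2,n}(\mu_{K(\gamma)})\ge c_n\qquad\text{for all } n\in\mathbb N,$$ where $\mu_{K(\gamma)}$ is the equilibrium measure of $K(\gamma)$.
   Context: $\mathbb N=\{1,2,3,\dots\}$. $\operatorname{Cap}$ denotes logarithmic capacity; a compact set $K\subset\mathbb C$ is non-polar if $\operatorname{Cap}(K)>0$, and then $\mu_K$ denotes its equilibrium measure (the unique probability measure on $K$ of minimal logarithmic energy). Widom factors for a measure. For a finite positive Borel measure $\mu$ with compact non-polar support $\operatorname{supp}(\mu)\subset\mathbb C$ and $n\in\mathbb N$, let $Q_n(\cdot;\mu)$ be the $n$-th monic orthogonal polynomial, i.e. the unique monic polynomial of degree $n$ minimizing $\|P_n\|_{L^2(\mu)}$ over all monic polynomials $P_n$ of degree $n$. Define $$W_{2,n}(\mu):=\frac{\|Q_n(\cdot;\mu)\|_{L^2(\mu)}}{\operatorname{Cap}(\operatorname{supp}(\mu))^n}.$$ The sets $K(\gamma)$. Let $\gamma=(\gamma_s)_{s=1}^\infty$ with $0<\gamma_s<1/4$ for all $s\in\mathbb N$. Put $r_0:=1$ and $r_s:=\gamma_s r_{s-1}^2$ for $s\ge1$.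 Define polynomials recursively by $P_2(x)=x(x-1)$ and $P_{2^{s+1}}(x):=P_{2^s}(x)\,(P_{2^s}(x)+r_s)$ for $s\ge 1$. Let $E_0:=[0,1]$ and, for $s\in\mathbb N$, $$E_s:=\left(\frac{2}{r_s}P_{2^s}+1\right)^{-1}([-1,1])=\left\{z\in\mathbb C:\ \frac{2}{r_s}P_{2^s}(z)+1\in[-1,1]\right\}.$$ Each $E_s$ is a disjoint union of $2^s$ non-trivial closed intervals contained in $[0,1]$, and $E_s\subset E_{s-1}$. Define $K(\gamma):=\bigcap_{s=0}^\infty E_s$. It is a Cantor set (a totally disconnected, perfect compact set) contained in $[0,1]$ and containing $0$ and $1$. *)

(* Defs.v *)
From HB Require Import structures.
From mathcomp Require Import all_boot all_order all_algebra.
From mathcomp Require Import all_classical all_reals all_analysis.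
From mathcomp Require Import complex.

Set Implicit Arguments.
Unset Strict Implicit.
Unset Printing Implicit Defensive.

Import Order.TTheory GRing.Theory Num.Theory ComplexField.Normc.
Import numFieldNormedType.Exports.

Local Open Scope classical_set_scope.
Local Open Scope ring_scope.
Local Open Scope complex_scope.

(* [R[i]^o] carries the topology of the modulus. *)
Notation borelC R := (g_sigma_algebraType (@open R[i]^o)).

Section LogPotential.
Variable R : realType.

(* Takes the value +oo on the diagonal, since [lne 0 = -oo]. *)
Definition log_kernel (z w : R[i]) : \bar R := (- lne (normc (z - w))%:E)%E.

Definition log_energy (mu : probability (borelC R) R) : \bar R :=
  (\int[mu]_z \int[mu]_w log_kernel z w)%E.

Definition prob_on (K : set R[i]) : set (probability (borelC R) R) :=
  [set mu | mu (~` K) = 0%E].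

(* The infimum is +oo when [K] is empty or polar, and then [Cap K = 0]. *)
Definition Cap (K : set R[i]) : R :=
  fine (expeR (- ereal_inf [set log_energy mu | mu in prob_on K])).

Definition is_equilibrium (K : set R[i]) (mu : probability (borelC R) R) :=
  prob_on K mu /\ forall nu, prob_on K nu -> (log_energy mu <= log_energy nu)%E.

(* For a compact non-polar [K], the unique measure satisfying
   [is_equilibrium K]; an unspecified point mass when there is none. *)
Definition equilibrium_measure (K : set R[i]) : probability (borelC R) R :=
  get (is_equilibrium K).

End LogPotential.

Section WidomFactor.
Variable R : realType.
Variable mu : {finite_measure set (borelC R) -> \bar R}.

Definition supp : set R[i] :=
  [set z | forall U : set R[i]^o, open U -> U z -> (0 < mu U)%E].

Definition L2norm (P : {poly R[i]}) : \bar R :=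
  Lnorm mu 2%:E (fun z => (normc P.[z])%:E).

Definition monic_deg (n : nat) (P : {poly R[i]}) :=
  P \is monic /\ size P = n.+1.

Definition is_monic_orthogonal (n : nat) (Q : {poly R[i]}) :=
  monic_deg n Q /\ forall P, monic_deg n P -> (L2norm Q <= L2norm P)%E.

(* The unique minimizer when [supp] is compact and infinite. *)
Definition monic_orthogonal (n : nat) : {poly R[i]} :=
  xget 'X^n (is_monic_orthogonal n).

Definition W2 (n : nat) : R :=
  fine (L2norm (monic_orthogonal n)) / Cap supp ^+ n.

End WidomFactor.

Section CantorSet.
Variables (R : realType) (gamma : nat -> R).

Fixpoint rseq (s : nat) : R :=
  if s is s'.+1 then gamma s * rseq s' ^+ 2 else 1.

(* The index is shifted by one: [Ppoly k] is P_{2^(k+1)}. *)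
Fixpoint Ppoly (k : nat) : {poly R[i]} :=
  if k is k'.+1 then Ppoly k' * (Ppoly k' + (rseq k)%:C%:P) else 'X * ('X - 1).

Definition segC (a b : R) : set R[i] := [set x%:C | x in `[a, b]].

Definition Eset (s : nat) : set R[i] :=
  if s is k.+1
  then [set z | segC (-1) 1 ((2 / rseq s)%:C * (Ppoly k).[z] + 1)]
  else segC 0 1.

Definition Kset : set R[i] := \bigcap_s Eset s.

End CantorSet.

(* Main.v *)
Require Import Defs.
From HB Require Import structures.
From mathcomp Require Import all_boot all_order all_algebra.
From mathcomp Require Import all_classical all_reals all_analysis.
From mathcomp Require Import measurable_realfun complex.
From mathcomp Require Import ring lra.

Set Implicit Arguments.
Unset Strict Implicit.
Unset Printing Implicit Defensive.

Import Order.TTheory GRing.Theory Num.Theory.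
Import numFieldNormedType.Exports.

(** Rescale the polynomials of the construction by v_0 = x and v_s = - P_{2^s} / r_s.
    Then v_(s+1) = v_s (1 - v_s) / gamma_(s+1), and K(gamma) is the set of points whose
    whole logistic orbit stays in [0, 1]. Forgetting the first s parameters gives Cantor
    sets K_s of the same kind; K_s is the preimage of K_(s+1) under one logistic step,
    and everything below is an induction along this chain.

    Choosing the two branches of each inverse step by independent fair coin tosses (the
    binary digits of a uniform number) gives a random point of K_s, with law mu_s. If y, y'
    are the two preimages of w and v is the image of x, then (x - y)(x - y') =
    gamma (w - v); hence the logarithmic potential of mu_s at a point of K_s is half of
    - ln gamma plus the potential of mu_(s+1) at a point of K_(s+1). So it is the constant
    V_s determined by 2 V_s = - ln gamma + V_(s+1), which is proved with the kernel
    - ln (d^2 + e^2) / 2 in place of - ln |d|, uniformly in e ([reg_potential_le],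
    [reg_potential_ge]), so that no infinite value occurs.

    The regularised kernel is conditionally positive definite: a Cayley transform zeta
    turns it, up to terms depending on one variable only, into - ln |1 - zeta conj(omega)|,
    a power series with positive coefficients. Keeping its first term, the energy of any
    probability nu on K exceeds V_0 by at least a positive multiple of the squared
    difference of the Stieltjes transforms of nu and mu_0 ([stieltjes_gap]). So V_0 is the
    minimal energy, the capacity is exp (- V_0), and every minimiser has the moments of
    mu_0 ([minimizer_mean_poly]). Only these moments matter for the L2 norms.

    For the L2 norms, write a monic p of degree n as even(p) + (1 - 2 x) odd(p) with both
    parts polynomials in the logistic image. As 1 - 2 x changes sign between the two
    branches, the mean of p^2 under mu_s is the sum of two means of squares of polynomials
    of half the degree under mu_(s+1). Since V_s >= ln 8, the Widom factors therefore
    satisfy W_(2m)(s) >= W_m(s+1) and W_(2m+1)(s) >= W_m(s+1); after j steps, with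
    2^j <= n < 2^(j+1), degree one is reached and W_n >= exp (V_j) / sqrt 8
    ([mean_sqr_ge]).

    It remains to choose V_s = 2^s tau_s + ln 8 with tau_s twice the supremum of
    (ln c_m) / m over m >= 2^s ([growth_potentials]). As tau decreases, the parameters
    gamma = exp (V_(s+1) - 2 V_s) are at most 1/8; as tau tends to 0, V_s / 2^s does too,
    which makes the potential exactly V_0; and exp (V_j) / 8 = exp (2^j tau_j) >= c_n. *)

Local Open Scope classical_set_scope.
Local Open Scope ring_scope.

(** * Means of bounded measurable functions *)

Section Expectation.
Context d (T : measurableType d) (R : realType).
Implicit Types (f g : T -> R).

(** Bounded measurable functions are integrable against every probability and stable
    under the operations used below, so that means can be manipulated without further
    integrability conditions. *)
Definition bmeas f := measurable_fun setT f /\ exists M, forall x, `|f x| <= M.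

Lemma bmeas_cst (c : R) : bmeas (fun=> c).
Proof. by split; [exact: measurable_cst | exists `|c|]. Qed.

Lemma bmeasD f g : bmeas f -> bmeas g -> bmeas (fun x => f x + g x).
Proof.
move=> [mf [M fM]] [mg [N gN]]; split; first exact: measurable_funD.
by exists (M + N) => x; rewrite (le_trans (ler_normD _ _))// lerD.
Qed.

Lemma bmeasM f g : bmeas f -> bmeas g -> bmeas (fun x => f x * g x).
Proof.
move=> [mf [M fM]] [mg [N gN]]; split; first exact: measurable_funM.
by exists (M * N) => x; rewrite normrM ler_pM.
Qed.

Lemma bmeasZ c f : bmeas f -> bmeas (fun x => c * f x).
Proof. by move=> bf; apply: bmeasM => //; exact: bmeas_cst. Qed.

Lemma bmeasN f : bmeas f -> bmeas (fun x => - f x).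
Proof.
move=> bf; have -> : (fun x => - f x) = (fun x => -1 * f x).
  by apply/funext => x; rewrite mulN1r.
exact: bmeasZ.
Qed.

Lemma bmeasB f g : bmeas f -> bmeas g -> bmeas (fun x => f x - g x).
Proof. by move=> bf bg; apply: bmeasD => //; exact: bmeasN. Qed.

Lemma bmeasX f n : bmeas f -> bmeas (fun x => f x ^+ n).
Proof.
move=> bf; elim: n => [|n IH].
  by under eq_fun do rewrite expr0; exact: bmeas_cst.
by under eq_fun do rewrite exprS; exact: bmeasM.
Qed.

Lemma bmeas_sum (I : Type) (s : seq I) (F : I -> T -> R) :
  (forall i, bmeas (F i)) -> bmeas (fun x => \sum_(i <- s) F i x).
Proof.
move=> bF; elim: s => [|i s IH].
  by under eq_fun do rewrite big_nil; exact: bmeas_cst.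
by under eq_fun do rewrite big_cons; exact: bmeasD.
Qed.

Lemma bmeas_comp (phi : R -> R) f :
  continuous phi -> bmeas f -> bmeas (phi \o f).
Proof.
move=> cphi [mf [M fM]]; split.
  by apply: measurableT_comp => //; exact: continuous_measurable_fun.
have M0 : - M <= M.
  by rewrite ge0_cp// (le_trans (normr_ge0 (f point)))// fM.
have cn : {within `[- M, M], continuous (fun x => `|phi x|)}.
  apply: continuous_subspaceT => x.
  by apply: continuous_comp; [exact: cphi | exact: norm_continuous].
have [c _ cmax] := EVT_max M0 cn.
by exists `|phi c| => x; apply: cmax; rewrite in_itv/= -ler_norml.
Qed.

Lemma bmeas_horner (p : {poly R}) f : bmeas f -> bmeas (fun x => p.[f x]).
Proof.
move=> bf; have -> : (fun x => p.[f x]) =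
    (fun x => \sum_(i <- index_enum 'I_(size p)) p`_i * f x ^+ i).
  by apply/funext => x; rewrite horner_coef.
by apply: bmeas_sum => i; apply: bmeasZ; exact: bmeasX.
Qed.

Variable P : probability T R.

Lemma bmeas_integrable f : bmeas f -> P.-integrable setT (EFin \o f).
Proof.
move=> [mf [M fM]]; apply: measurable_bounded_integrable => //.
  by apply: (le_lt_trans (probability_le1 P measurableT)); rewrite ltry.
exists M; split; first exact: num_real.
by move=> N MN x _; exact: le_trans (fM x) (ltW MN).
Qed.

Lemma meanD f g : bmeas f -> bmeas g ->
  \int[P]_x (f x + g x) = \int[P]_x f x + \int[P]_x g x.
Proof. by move=> bf bg; apply: RintegralD => //; exact: bmeas_integrable. Qed.

Lemma meanB f g : bmeas f -> bmeas g ->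
  \int[P]_x (f x - g x) = \int[P]_x f x - \int[P]_x g x.
Proof. by move=> bf bg; apply: RintegralB => //; exact: bmeas_integrable. Qed.

Lemma meanZ c f : bmeas f -> \int[P]_x (c * f x) = c * \int[P]_x f x.
Proof. by move=> bf; apply: RintegralZl => //; exact: bmeas_integrable. Qed.

Lemma mean_cst c : \int[P]_x c = c :> R.
Proof.
rewrite [LHS](Rintegral_cst P measurableT).
by rewrite [X in fine X](_ : _ = 1%E) ?mulr1//; exact: probability_setT.
Qed.

Lemma mean_sum (I : Type) (s : seq I) (F : I -> T -> R) :
  (forall i, bmeas (F i)) ->
  \int[P]_x (\sum_(i <- s) F i x) = \sum_(i <- s) \int[P]_x F i x.
Proof.
move=> bF; elim: s => [|i s IH].
  by rewrite big_nil -[RHS]mean_cst; apply: eq_Rintegral => x _; rewrite big_nil.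
rewrite big_cons -IH -meanD//; last exact: bmeas_sum.
by apply: eq_Rintegral => x _; rewrite big_cons.
Qed.

Lemma le_mean f g : bmeas f -> bmeas g -> (forall x, f x <= g x) ->
  \int[P]_x f x <= \int[P]_x g x.
Proof.
by move=> bf bg fg; apply: le_Rintegral => //; exact: bmeas_integrable.
Qed.

Lemma mean_le f c : bmeas f -> (forall x, f x <= c) -> \int[P]_x f x <= c.
Proof.
by move=> bf fc; rewrite -[leRHS]mean_cst; apply: le_mean => //; exact: bmeas_cst.
Qed.

Lemma le_mean_cst f c : bmeas f -> (forall x, c <= f x) -> c <= \int[P]_x f x.
Proof.
by move=> bf fc; rewrite -[leLHS]mean_cst; apply: le_mean => //; exact: bmeas_cst.
Qed.

Lemma mean_EFin f : bmeas f ->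
  (\int[P]_x (f x)%:E)%E = (\int[P]_x f x)%:E.
Proof.
move=> bf; rewrite /Rintegral fineK//.
by apply: integrable_fin_num => //; exact: bmeas_integrable.
Qed.

End Expectation.

Section ProductMean.
Context d1 d2 (T1 : measurableType d1) (T2 : measurableType d2) (R : realType).
Variables (P : probability T1 R) (Q : probability T2 R).

Definition prodP : probability (T1 * T2)%type R := (P \x Q)%E.

Lemma bmeas_fst (f : T1 -> R) : bmeas f ->
  bmeas (fun z : T1 * T2 => f z.1).
Proof.
move=> [mf [M fM]]; split; last by exists M.
by apply: measurableT_comp => //; exact: measurable_fst.
Qed.

Lemma bmeas_snd (f : T2 -> R) : bmeas f ->
  bmeas (fun z : T1 * T2 => f z.2).
Proof.
move=> [mf [M fM]]; split; last by exists M.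
by apply: measurableT_comp => //; exact: measurable_snd.
Qed.

Lemma bmeas_section (F : T1 * T2 -> R) x : bmeas F -> bmeas (fun y => F (x, y)).
Proof.
by move=> [mF [M FM]]; split; [exact: measurableT_comp | exists M].
Qed.

Lemma iterated_mean (F : T1 * T2 -> R) : bmeas F ->
  \int[prodP]_z F z = \int[P]_x \int[Q]_y F (x, y).
Proof.
move=> bF; rewrite {1}/Rintegral.
rewrite -(integral12_prod_meas1 (f := EFin \o F)); last exact: bmeas_integrable.
congr fine; apply: eq_integral => x _.
by rewrite /fubini_F/= mean_EFin//; exact: bmeas_section.
Qed.

Lemma bmeas_mean_section (F : T1 * T2 -> R) : bmeas F ->
  bmeas (fun x => \int[Q]_y F (x, y)).
Proof.
move=> bF; have bs x := bmeas_section x bF; split.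
  apply/measurable_EFinP; rewrite (_ : _ \o _ = fubini_F Q (EFin \o F)).
    by apply: (@measurable_fubini_F _ _ _ _ _ P); exact: bmeas_integrable.
  by apply/funext => x; rewrite /fubini_F/= mean_EFin.
case: bF => _ [M FM]; exists M => x; rewrite ler_norml; apply/andP; split.
  by apply: le_mean_cst => // y; move: (FM (x, y)); rewrite ler_norml => /andP[].
by apply: mean_le => // y; move: (FM (x, y)); rewrite ler_norml => /andP[].
Qed.

Lemma mean_prod (f : T1 -> R) (g : T2 -> R) : bmeas f -> bmeas g ->
  \int[prodP]_z (f z.1 * g z.2) = (\int[P]_x f x) * (\int[Q]_y g y).
Proof.
move=> bf bg; rewrite iterated_mean; last first.
  by apply: bmeasM; [exact: bmeas_fst | exact: bmeas_snd].
rewrite mulrC -meanZ//; apply: eq_Rintegral => x _ /=.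
by rewrite meanZ// mulrC.
Qed.

Lemma mean_fst (f : T1 -> R) : bmeas f ->
  \int[prodP]_z f z.1 = \int[P]_x f x.
Proof.
move=> bf; rewrite iterated_mean; last exact: bmeas_fst.
by apply: eq_Rintegral => x _ /=; rewrite mean_cst.
Qed.

Lemma mean_snd (g : T2 -> R) : bmeas g ->
  \int[prodP]_z g z.2 = \int[Q]_y g y.
Proof.
move=> bg; rewrite iterated_mean; last exact: bmeas_snd.
by rewrite -[RHS](mean_cst P); apply: eq_Rintegral.
Qed.

End ProductMean.

(** * The power series of the logarithm *)

Section LogSeries.
Variables (R : realType) (c : nat -> R) (a r q : R).
Hypotheses (c0 : c 0 = 1) (c1 : c 1 = a).
Hypothesis crec : forall n, c n.+2 = 2 * a * c n.+1 - r * c n.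
Hypotheses (q0 : 0 <= q) (q1 : q < 1) (cq : forall n, `|c n| <= q ^+ n).
Hypotheses (ar : a ^+ 2 <= r) (rq : r <= q ^+ 2).

Let den (t : R) := 1 - 2 * t * a + t ^+ 2 * r.

(** den t = |1 - t w|^2, which is at least (1 - |w|)^2. *)
Let den_ge (t : R) : 0 <= t -> t <= 1 -> (1 - q) ^+ 2 <= den t.
Proof.
move=> t0 t1; have aq : `|a| <= q by rewrite -c1 (le_trans (cq 1))// expr1.
have /andP[aq1 aq2] : - q <= a <= q by rewrite -ler_norml.
have taq : t * a <= q.
  have : 0 <= t * (q - a) by rewrite mulr_ge0// subr_ge0.
  have : 0 <= q * (1 - t) by rewrite mulr_ge0// subr_ge0.
  by lra.
have hq := q1.
have : (1 - q) ^+ 2 <= (1 - t * a) ^+ 2.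
  have h1 : 0 <= 1 - q by rewrite subr_ge0 ltW. have h2 : 0 <= 1 - t * a by lra. by rewrite ler_pXn2r//; lra.
have : (t * a) ^+ 2 <= t ^+ 2 * r by rewrite exprMn ler_wpM2l// sqr_ge0.
by rewrite /den; lra.
Qed.

Let den_gt0 (t : R) : 0 <= t -> t <= 1 -> 0 < den t.
Proof. by move=> t0 t1; apply: lt_le_trans (den_ge t0 t1); rewrite exprn_gt0// subr_gt0. Qed.

Let psum N : {poly R} := \sum_(n < N) (c n.+1 / n.+1%:R) *: 'X^(n.+1).
Let dpsum N (t : R) := \sum_(n < N) c n.+1 * t ^+ n.

Let deriv_psum N (t : R) : (psum N)^`().[t] = dpsum N t.
Proof.
rewrite /psum /dpsum raddf_sum horner_sum; apply: eq_bigr => n _ /=.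
rewrite derivZ derivXn/= hornerZ hornerMn hornerXn -[t ^+ n *+ _]mulr_natr.
by rewrite mulrACA mulVf ?mulr1 ?pnatr_eq0.
Qed.

(** The partial geometric sum telescopes against den by the recurrence of c. *)
Let den_dpsum N (t : R) :
  den t * dpsum N t = a - t * r - (t ^+ N * c N.+1 - t ^+ N.+1 * r * c N).
Proof.
elim: N => [|N IH]; rewrite /dpsum.
  by rewrite big_ord0 mulr0 expr0 expr1 c0 c1; ring.
by rewrite big_ord_recr/= mulrDr IH crec /den !exprS; ring.
Qed.

Let is_derive_lnden (t : R) : 0 <= t -> t <= 1 ->
  is_derive t 1 (@ln R \o den) (- 2 * ((a - t * r) / den t)).
Proof.
move=> t0 t1; have d0 := den_gt0 t0 t1.
have hd : is_derive t (1:R) den (- 2 * a + 2 * t * r).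
  have -> : den = horner (1 - (2 * a) *: 'X + r *: 'X^2).
    apply/funext => x; rewrite /den !hornerE/=; ring.
  apply: is_derive_eq (is_derive_poly _ t) _.
  by rewrite !poly.derivE !hornerE/=; ring.
have hl := is_derive1_ln d0.
have h := is_derive1_comp hl hd; apply: is_derive_eq h _.
by rewrite mulrC [RHS]mulrA; congr (_ * _); ring.
Qed.

(** With c n the real part of w^n, a that of w and r = |w|^2, this is
    - ln |1 - w| = sum of Re (w^n) / n with an explicit error. The recurrence makes the
    derivative along t w of the difference to the partial sum collapse to two boundary
    terms, and the mean value theorem on [0, 1] bounds it. *)
Lemma ln_power_series_error N :
  `| - (1 / 2) * ln (1 - 2 * a + r) - \sum_(n < N) c n.+1 / n.+1%:R |
    <= 2 * q ^+ N.+1 / (1 - q) ^+ 2.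
Proof.
pose phi t := ln (den t) + (2 *: psum N).[t].
pose dphi t := (a - t * r) / den t - dpsum N t.
have dphiP (t : R) : 0 <= t -> t <= 1 -> is_derive t (1:R) phi (- 2 * dphi t).
  move=> t0 t1; have -> : -2 * dphi t =
      - 2 * ((a - t * r) / den t) + (2 *: psum N)^`().[t].
    by rewrite derivZ hornerZ deriv_psum /dphi; ring.
  by apply: is_deriveD; exact: is_derive_lnden.
have dphi01 (t : R) : t \in `]0, 1[ -> is_derive t (1:R) phi (- 2 * dphi t).
  by move=> /[!in_itv]/= /andP[t0 t1]; apply: dphiP; exact: ltW.
have cphi : {within `[0, 1], continuous phi}.
  apply: derivable_within_continuous => t /[!in_itv]/= /andP[t0 t1].
  by have [] := dphiP t t0 t1.
have [t] := MVT_segment ler01 dphi01 cphi.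
rewrite in_itv/= => /andP[t0 t1]; rewrite subr0 mulr1.
have -> : phi 0 = 0.
  rewrite /phi /den mulr0 mul0r subr0 expr0n mul0r addr0 ln1 add0r hornerZ.
  by rewrite /psum horner_sum big1 ?mulr0// => i _; rewrite !hornerE expr0n mulr0.
rewrite subr0 {1}/phi {1}/den expr1n mulr1 mul1r hornerZ {1}/psum horner_sum.
rewrite (eq_bigr (fun n : 'I_N => c n.+1 / n.+1%:R)); last first.
  by move=> n _; rewrite hornerZ hornerXn expr1n mulr1.
set s := \sum_(_ < _) _ => phi1.
have -> : - (1 / 2) * ln (1 - 2 * a + r) - s = dphi t by lra.
have d0 := den_gt0 t0 t1.
have -> : dphi t = (t ^+ N * c N.+1 - t ^+ N.+1 * r * c N) / den t.
  have := den_dpsum N t; rewrite /dphi => H.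
  by apply: (mulIf (lt0r_neq0 d0)); rewrite mulrBl !divfK ?lt0r_neq0// mulrC [dpsum _ _ * _]mulrC; lra.
rewrite normrM normfV (gtr0_norm d0) ler_pM ?invr_ge0//.
- exact: ltW.
- rewrite (le_trans (ler_normB _ _))// mulr2n mulrDl mul1r lerD//.
    by rewrite normrM -[leRHS]mul1r ler_pM// normrX ?exprn_ile1// ger0_norm.
  have r0 : 0 <= r by rewrite (le_trans _ ar)// sqr_ge0.
  rewrite -mulrA normrM -[leRHS]mul1r ler_pM//.
    by rewrite ger0_norm ?exprn_ge0// exprn_ile1.
  rewrite normrM ger0_norm// (le_trans (ler_pM _ _ rq (cq N)))// -exprD.
  by apply: ler_wiXn2l => //; exact: ltW.
- by rewrite lef_pV2 ?posrE ?den_ge// exprn_gt0// subr_gt0.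
Qed.
End LogSeries.

(** * Conditional positive definiteness of the regularised logarithmic kernel *)

Lemma geometric_lt (R : realType) (C q eps : R) :
  0 <= q -> q < 1 -> 0 < eps -> exists N : nat, C * q ^+ N < eps.
Proof.
move=> q0 q1 e0; have q1' : `|q| < 1 by rewrite ger0_norm.
have /cvgrPdist_lt/(_ eps e0)[N _ /(_ N (leqnn _))] := cvg_geometric C q1'.
rewrite /geometric/= sub0r normrN => h; exists N.
exact: le_lt_trans (ler_norm _) h.
Qed.

Section DotPowers.
Variable R : realType.
Implicit Types z w : R[i].

(** The real part of z conj(w): the products whose mean is a sum of products of means. *)
Definition dotC z w := complex.Re z * complex.Re w + complex.Im z * complex.Im w.

Lemma Re_mulc z w : complex.Re (z * w) = complex.Re z * complex.Re w - complex.Im z * complex.Im w.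
Proof. by case: z w => [? ?] [? ?]. Qed.

Lemma Im_mulc z w : complex.Im (z * w) = complex.Re z * complex.Im w + complex.Im z * complex.Re w.
Proof. by case: z w => [? ?] [? ?]. Qed.

Lemma dotC_rec z w n : dotC (z ^+ n.+2) (w ^+ n.+2) =
  2 * dotC z w * dotC (z ^+ n.+1) (w ^+ n.+1)
  - dotC z z * dotC w w * dotC (z ^+ n) (w ^+ n).
Proof. by rewrite /dotC !(exprS _ n.+1) !(exprS _ n) !(Re_mulc, Im_mulc); ring. Qed.

Lemma dotC_expr z n : dotC (z ^+ n) (z ^+ n) = dotC z z ^+ n.
Proof.
elim: n => [|n IH]; first by rewrite /dotC !expr0/=; ring.
by rewrite !(exprS _ n) -IH /dotC !(Re_mulc, Im_mulc); ring.
Qed.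

Lemma dotC_ge0 z : 0 <= dotC z z.
Proof. by rewrite addr_ge0// -expr2 sqr_ge0. Qed.

(** Cauchy-Schwarz, as |z^n|^2 = (|z|^2)^n. *)
Lemma norm_dotC_expr z w q n : dotC z z <= q -> dotC w w <= q ->
  `|dotC (z ^+ n) (w ^+ n)| <= q ^+ n.
Proof.
move=> zq wq; have q0 := le_trans (dotC_ge0 z) zq.
have hz : dotC (z ^+ n) (z ^+ n) <= q ^+ n.
  by rewrite dotC_expr lerXn2r ?nnegrE// dotC_ge0.
have hw : dotC (w ^+ n) (w ^+ n) <= q ^+ n.
  by rewrite dotC_expr lerXn2r ?nnegrE// dotC_ge0.
move: hz hw; rewrite /dotC; set a := complex.Re _; set b := complex.Im _.
set c := complex.Re _; set d := complex.Im _ => h1 h2.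
have s1 := sqr_ge0 (a - c); have s2 := sqr_ge0 (b - d).
have s3 := sqr_ge0 (a + c); have s4 := sqr_ge0 (b + d).
by rewrite ler_norml; apply/andP; split; lra.
Qed.

Lemma dotC_CauchySchwarz z w : dotC z w ^+ 2 <= dotC z z * dotC w w.
Proof.
rewrite -subr_ge0 (_ : _ - _ = (complex.Re z * complex.Im w - complex.Im z * complex.Re w) ^+ 2).
  exact: sqr_ge0.
by rewrite /dotC; ring.
Qed.

End DotPowers.

Section Cayley.
Variable R : realType.
Implicit Types (b c e x y : R).

(** - ln |d|, with the singularity smoothed at scale e. *)
Definition reglog e d : R := - (1 / 2) * ln (d ^+ 2 + e ^+ 2).

(** The Cayley transform ((x + i e/2) - i r) / ((x + i e/2) + i r) of the line at height
    e/2, with b = r + e/2 and c = r - e/2. It maps the line inside the unit disc because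
    c < b. *)
Definition cayley b c x : R[i] :=
  ((x ^+ 2 - b * c) / (x ^+ 2 + b ^+ 2) +i* (- (x * (b + c)) / (x ^+ 2 + b ^+ 2)))%C.

Definition cayley_weight b c x : R := - (1 / 2) * ln ((x ^+ 2 + b ^+ 2) / (b + c)).

Lemma dotC_cayley b c x : 0 < b ->
  dotC (cayley b c x) (cayley b c x) = (x ^+ 2 + c ^+ 2) / (x ^+ 2 + b ^+ 2).
Proof.
move=> b0; rewrite /dotC /cayley/=; field.
by rewrite lt0r_neq0// ltr_wpDl ?sqr_ge0// exprn_gt0.
Qed.

Lemma dotC_cayley_le b c x : 0 <= c -> c < b -> 0 <= x -> x <= 1 ->
  dotC (cayley b c x) (cayley b c x) <= (1 + c ^+ 2) / (1 + b ^+ 2).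
Proof.
move=> c0 cb x0 x1; have b0 : 0 < b by exact: le_lt_trans cb.
rewrite dotC_cayley// ler_pdivrMr ?ltr_wpDl ?sqr_ge0 ?exprn_gt0//.
rewrite mulrAC ler_pdivlMr ?ltr_wpDl ?exprn_gt0//.
have : 0 <= (b ^+ 2 - c ^+ 2) * (1 - x ^+ 2).
  rewrite mulr_ge0// subr_ge0 ?exprn_ile1//.
  by rewrite lerXn2r ?nnegrE// ltW.
lra.
Qed.

(** The identity |1 - zeta conj(omega)|^2 = (b + c)^2 ((x - y)^2 + (b - c)^2)
    / ((x^2 + b^2) (y^2 + b^2)) between Cayley transforms zeta, omega of x, y. *)
Lemma reglog_cayley b c x y : 0 <= c -> c < b ->
  reglog (b - c) (x - y) = cayley_weight b c x + cayley_weight b c y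
    - (1 / 2) * ln (1 - 2 * dotC (cayley b c x) (cayley b c y)
      + dotC (cayley b c x) (cayley b c x) * dotC (cayley b c y) (cayley b c y)).
Proof.
move=> c0 cb; have b0 : 0 < b by exact: le_lt_trans cb.
have D0 t : 0 < t ^+ 2 + b ^+ 2 by rewrite ltr_wpDl ?sqr_ge0// exprn_gt0.
have bc0 : 0 < b + c by rewrite ltr_wpDr.
have e0 : 0 < (x - y) ^+ 2 + (b - c) ^+ 2.
  by rewrite ltr_wpDl ?sqr_ge0// exprn_gt0// subr_gt0.
have -> : 1 - 2 * dotC (cayley b c x) (cayley b c y)
      + dotC (cayley b c x) (cayley b c x) * dotC (cayley b c y) (cayley b c y)
  = ((x - y) ^+ 2 + (b - c) ^+ 2) / ((x ^+ 2 + b ^+ 2) / (b + c))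
     / ((y ^+ 2 + b ^+ 2) / (b + c)).
  rewrite !dotC_cayley// /dotC /cayley/=; field.
  by rewrite !lt0r_neq0.
rewrite !ln_div ?posrE ?divr_gt0// /reglog /cayley_weight !ln_div ?posrE//.
by ring.
Qed.

Lemma reglog_expansion b c x y q N : 0 <= c -> c < b ->
  q = (1 + c ^+ 2) / (1 + b ^+ 2) -> 0 <= x <= 1 -> 0 <= y <= 1 ->
  `| reglog (b - c) (x - y) - (cayley_weight b c x + cayley_weight b c y)
     - \sum_(n < N) dotC (cayley b c x ^+ n.+1) (cayley b c y ^+ n.+1) / n.+1%:R |
  <= 2 * q ^+ N.+1 / (1 - q) ^+ 2.
Proof.
move=> c0 cb qE /andP[x0 x1] /andP[y0 y1].
have b0 : 0 < b by exact: le_lt_trans cb.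
have q0 : 0 <= q by rewrite qE divr_ge0// addr_ge0// sqr_ge0.
have q1 : q < 1.
  rewrite qE ltr_pdivrMr ?mul1r; last by rewrite ltr_wpDl ?exprn_gt0.
  by rewrite ltrD2l ltrXn2r// nnegrE ltW.
have hx := dotC_cayley_le c0 cb x0 x1; have hy := dotC_cayley_le c0 cb y0 y1.
rewrite -qE in hx hy.
have cancel (u v l : R) : u + v - (1 / 2) * l - (u + v) = - (1 / 2) * l by ring.
rewrite reglog_cayley// cancel.
apply: (ln_power_series_error (c := fun n =>
  dotC (cayley b c x ^+ n) (cayley b c y ^+ n))) => //.
- by rewrite /dotC !expr0/=; ring.
- by move=> n; rewrite dotC_rec.
- by move=> n; exact: norm_dotC_expr.
- exact: dotC_CauchySchwarz.
- by rewrite expr2 ler_pM// dotC_ge0.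
Qed.

End Cayley.

Lemma continuous_reglog (R : realType) (e : R) : 0 < e -> continuous (reglog e).
Proof.
move=> e0; have -> : reglog e = (fun d => - (1 / 2) * ln ('X^2 + (e ^+ 2)%:P).[d]).
  by apply/funext => x; rewrite /reglog !hornerE.
move=> x; apply: cvgM; first exact: cvg_cst.
apply: continuous_comp; first exact: continuous_horner.
by apply: continuous_ln; rewrite !hornerE ltr_wpDl ?exprn_gt0// sqr_ge0.
Qed.

Lemma bmeas_reglog d (T : measurableType d) (R : realType) (e : R) (f : T -> R) :
  0 < e -> bmeas f -> bmeas (fun t => reglog e (f t)).
Proof.
move=> e0 bf; apply: (bmeas_comp (phi := reglog e)) => //.
exact: continuous_reglog.
Qed.

Lemma continuous_rational (R : realType) (b : R) (p : {poly R}) : 0 < b ->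
  continuous (fun x : R => p.[x] / (x ^+ 2 + b ^+ 2)).
Proof.
move=> b0; have hc : continuous (fun x : R => x ^+ 2 + b ^+ 2).
  have -> : (fun x : R => x ^+ 2 + b ^+ 2) = horner ('X^2 + (b ^+ 2)%:P).
    by apply/funext => y; rewrite !hornerE.
  exact: continuous_horner.
move=> x; apply: cvgM; first exact: continuous_horner.
apply: cvgV; last exact: hc.
by rewrite lt0r_neq0// ltr_wpDl ?sqr_ge0// exprn_gt0.
Qed.

Section PositiveDefinite.
Variable R : realType.
Variables (b c : R).
Hypotheses (c0 : 0 <= c) (cb : c < b).

Let b0 : 0 < b. Proof. exact: le_lt_trans cb. Qed.

Section One.
Context d (T : measurableType d).
Variable X : T -> R.
Hypothesis (bX : bmeas X).

Lemma bmeas_cayley_weight : bmeas (fun t => cayley_weight b c (X t)).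
Proof.
apply: (bmeas_comp (phi := cayley_weight b c)) => //.
have -> : cayley_weight b c =
    (fun d => - (1 / 2) * ln ((b + c)^-1 *: ('X^2 + (b ^+ 2)%:P)).[d]).
  by apply/funext => x; rewrite /cayley_weight !hornerE [_ / (b + c)]mulrC.
move=> x; apply: cvgM; first exact: cvg_cst.
apply: continuous_comp; first exact: continuous_horner.
apply: continuous_ln; rewrite !hornerE. 
have h := exprn_gt0 2 b0; have h' := sqr_ge0 x; have h2 := b0; have h3 := c0.
by rewrite mulr_gt0 ?invr_gt0//; lra.
Qed.

Lemma bmeas_cayley_expr n :
  bmeas (fun t => complex.Re (cayley b c (X t) ^+ n)) /\
  bmeas (fun t => complex.Im (cayley b c (X t) ^+ n)).
Proof.
have hr : bmeas (fun t => complex.Re (cayley b c (X t))).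
  rewrite /cayley/=; apply: (bmeas_comp (phi := fun x => (x ^+ 2 - b * c) / (x ^+ 2 + b ^+ 2))) => //.
  have -> : (fun x => (x ^+ 2 - b * c) / (x ^+ 2 + b ^+ 2)) =
     fun x => ('X^2 - (b * c)%:P).[x] / (x ^+ 2 + b ^+ 2).
    by apply/funext => x; rewrite !hornerE.
  exact: continuous_rational b0.
have hi : bmeas (fun t => complex.Im (cayley b c (X t))).
  rewrite /cayley/=; apply: (bmeas_comp (phi := fun x => - (x * (b + c)) / (x ^+ 2 + b ^+ 2))) => //.
  have -> : (fun x => - (x * (b + c)) / (x ^+ 2 + b ^+ 2)) =
     fun x => (- (b + c) *: 'X).[x] / (x ^+ 2 + b ^+ 2).
    by apply/funext => x; rewrite !hornerE; congr (_ / _); ring.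
  exact: continuous_rational b0.
elim: n => [|n [IH1 IH2]].
  by split; under eq_fun do rewrite expr0/=; exact: bmeas_cst.
split.
- by under eq_fun do rewrite exprS Re_mulc; apply: bmeasB; exact: bmeasM.
- by under eq_fun do rewrite exprS Im_mulc; apply: bmeasD; exact: bmeasM.
Qed.

End One.

(** The mutual energy of the laws of two random variables for the smoothed kernel. *)
Definition reg_mutual e d1 d2 (T1 : measurableType d1) (T2 : measurableType d2)
    (P : probability T1 R) (X : T1 -> R) (Q : probability T2 R) (Y : T2 -> R) : R :=
  \int[prodP P Q]_z reglog e (X z.1 - Y z.2).

Let meanh d (T : measurableType d) (P : probability T R) (X : T -> R) :=
  \int[P]_t cayley_weight b c (X t).
Let meanRe d (T : measurableType d) (P : probability T R) (X : T -> R) n :=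
  \int[P]_t complex.Re (cayley b c (X t) ^+ n).
Let meanIm d (T : measurableType d) (P : probability T R) (X : T -> R) n :=
  \int[P]_t complex.Im (cayley b c (X t) ^+ n).
Let q := (1 + c ^+ 2) / (1 + b ^+ 2).
Let delta N := 2 * q ^+ N.+1 / (1 - q) ^+ 2.

Lemma reg_mutual_expansion d1 d2 (T1 : measurableType d1) (T2 : measurableType d2)
    (P : probability T1 R) (X : T1 -> R) (Q : probability T2 R) (Y : T2 -> R) N :
  bmeas X -> bmeas Y -> (forall t, 0 <= X t <= 1) -> (forall t, 0 <= Y t <= 1) ->
  `| reg_mutual (b - c) P X Q Y - (meanh P X + meanh Q Y)
     - \sum_(n < N) (meanRe P X n.+1 * meanRe Q Y n.+1
                   + meanIm P X n.+1 * meanIm Q Y n.+1) / n.+1%:R | <= delta N.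
Proof.
move=> bX bY X01 Y01.
have bK : bmeas (fun z : T1 * T2 => reglog (b - c) (X z.1 - Y z.2)).
  apply: bmeas_reglog; first by rewrite subr_gt0.
  by apply: bmeasB; [exact: bmeas_fst | exact: bmeas_snd].
have bW : bmeas (fun z : T1 * T2 => cayley_weight b c (X z.1) + cayley_weight b c (Y z.2)).
  apply: bmeasD.
    exact: (bmeas_fst _ (bmeas_cayley_weight bX)).
  exact: (bmeas_snd _ (bmeas_cayley_weight bY)).
have bD n : bmeas (fun z : T1 * T2 => dotC (cayley b c (X z.1) ^+ n) (cayley b c (Y z.2) ^+ n)).
  have [h1 h2] := bmeas_cayley_expr bX n; have [h3 h4] := bmeas_cayley_expr bY n.
  apply: bmeasD; apply: bmeasM; [exact: (bmeas_fst _ h1) | exact: (bmeas_snd _ h3) | exact: (bmeas_fst _ h2) | exact: (bmeas_snd _ h4)].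
have bS : bmeas (fun z : T1 * T2 =>
    \sum_(n < N) dotC (cayley b c (X z.1) ^+ n.+1) (cayley b c (Y z.2) ^+ n.+1) / n.+1%:R).
  apply: bmeas_sum => n; apply: bmeasM; [exact: bD | exact: bmeas_cst].
have -> : reg_mutual (b - c) P X Q Y - (meanh P X + meanh Q Y)
     - \sum_(n < N) (meanRe P X n.+1 * meanRe Q Y n.+1
                   + meanIm P X n.+1 * meanIm Q Y n.+1) / n.+1%:R =
  \int[prodP P Q]_z (reglog (b - c) (X z.1 - Y z.2)
   - (cayley_weight b c (X z.1) + cayley_weight b c (Y z.2))
   - \sum_(n < N) dotC (cayley b c (X z.1) ^+ n.+1) (cayley b c (Y z.2) ^+ n.+1) / n.+1%:R).
  rewrite !meanB//; last exact: bmeasB.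
  congr (_ - _ - _).
    rewrite meanD.
    - congr (_ + _).
        by rewrite (mean_fst P Q (bmeas_cayley_weight bX)).
      by rewrite (mean_snd P Q (bmeas_cayley_weight bY)).
    - exact: (bmeas_fst _ (bmeas_cayley_weight bX)).
    - exact: (bmeas_snd _ (bmeas_cayley_weight bY)).
  rewrite mean_sum; last by move=> n; apply: bmeasM; [exact: bD | exact: bmeas_cst].
  apply: eq_bigr => n _.
  under [RHS]eq_Rintegral do rewrite mulrC.
  rewrite meanZ; last exact: bD.
  rewrite mulrC; congr (_ * _).
  have [h1 h2] := bmeas_cayley_expr bX n.+1; have [h3 h4] := bmeas_cayley_expr bY n.+1.
  rewrite [RHS]meanD.
  - by rewrite (mean_prod P Q h1 h3) (mean_prod P Q h2 h4).
  - by apply: bmeasM; [exact: (bmeas_fst _ h1) | exact: (bmeas_snd _ h3)].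
  - by apply: bmeasM; [exact: (bmeas_fst _ h2) | exact: (bmeas_snd _ h4)].
have bE := bmeasB (bmeasB bK bW) bS.
rewrite ler_norml; apply/andP; split.
- apply: le_mean_cst => // z.
  by have := reglog_expansion N c0 cb (erefl q) (X01 z.1) (Y01 z.2); rewrite ler_norml => /andP[].
- apply: mean_le => // z.
  by have := reglog_expansion N c0 cb (erefl q) (X01 z.1) (Y01 z.2); rewrite ler_norml => /andP[].
Qed.

(** The terms depending on one variable cancel in the combination on the right, and what
    remains is a series of squares; only its first term is kept. *)
Lemma reg_mutual_ge_gap d1 d2 (T1 : measurableType d1) (T2 : measurableType d2)
    (P : probability T1 R) (X : T1 -> R) (Q : probability T2 R) (Y : T2 -> R) :
  bmeas X -> bmeas Y -> (forall t, 0 <= X t <= 1) -> (forall t, 0 <= Y t <= 1) ->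
  (meanRe P X 1 - meanRe Q Y 1) ^+ 2 + (meanIm P X 1 - meanIm Q Y 1) ^+ 2 <=
  reg_mutual (b - c) P X P X + reg_mutual (b - c) Q Y Q Y - 2 * reg_mutual (b - c) P X Q Y.
Proof.
move=> bX bY X01 Y01; rewrite leNgt; apply/negP.
set A := _ - 2 * _; set B := _ ^+ 2 + _ => AB.
have q0 : 0 <= q by rewrite divr_ge0// addr_ge0// sqr_ge0.
have q1 : q < 1.
  rewrite ltr_pdivrMr ?mul1r; last by rewrite ltr_wpDl ?exprn_gt0.
  by rewrite ltrD2l ltrXn2r// nnegrE ltW.
have BA : 0 < B - A by rewrite subr_gt0.
have [N hN] := geometric_lt (4 * (2 * q ^+ 2 / (1 - q) ^+ 2)) q0 q1 BA.
have hd : 4 * delta N.+1 < B - A.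
  suff -> : 4 * delta N.+1 = 4 * (2 * q ^+ 2 / (1 - q) ^+ 2) * q ^+ N by [].
  rewrite /delta (exprD q 2 N : q ^+ N.+2 = _); move: (_ ^- 2) (q ^+ N) => u v; ring.
have h1 := reg_mutual_expansion P P N.+1 bX bX X01 X01.
have h2 := reg_mutual_expansion Q Q N.+1 bY bY Y01 Y01.
have h3 := reg_mutual_expansion P Q N.+1 bX bY X01 Y01.
move: h1 h2 h3; rewrite !ler_norml.
set s1 := \sum_(_ < _) _; set s2 := \sum_(_ < _) _; set s3 := \sum_(_ < _) _.
move=> /andP[h1 h1'] /andP[h2 h2'] /andP[h3 h3'].
have hs : B <= s1 + s2 - 2 * s3.
  have -> : s1 + s2 - 2 * s3 = \sum_(n < N.+1)
     ((meanRe P X n.+1 - meanRe Q Y n.+1) ^+ 2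
     + (meanIm P X n.+1 - meanIm Q Y n.+1) ^+ 2) / n.+1%:R.
    rewrite mulr_sumr -big_split -sumrB; apply: eq_bigr => n _ /=.
    by rewrite -!mulrDl mulrA -mulrBl; congr (_ / _); ring.
  rewrite big_ord_recl/= divr1 lerDl sumr_ge0// => n _.
  by rewrite divr_ge0// addr_ge0// sqr_ge0.
by rewrite /A in hd; lra.
Qed.

End PositiveDefinite.

(** * Halving the uniform distribution *)

Section DyadicMap.
Variable R : realType.
Local Notation lambda := (@lebesgue_measure R).
Local Notation TR := (measurableTypeR R).

Definition half_shift (c t : R) : R := t / 2 + c.

Lemma measurable_half_shift c : measurable_fun setT (half_shift c : TR -> TR).
Proof.
apply: measurable_funD; last exact: measurable_cst.
by apply: measurable_funM; [exact: measurable_id | exact: measurable_cst].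
Qed.

Lemma lebesgue_measure_half_shift c (A : set TR) : measurable A ->
  lambda A = ((2^-1)%:E * pushforward lambda (half_shift c : TR -> TR) A)%E.
Proof.
move=> mA; have mh := @measurable_half_shift c.
unshelve apply: (@lebesgue_measure_unique R
  (mscale (2^-1 : R)%:nng (pushforward lambda (half_shift c : TR -> TR)))) => //=.
move=> _ [[a b]] _ <-.
rewrite /mscale/= /pushforward.
have -> : half_shift c @^-1` [set` Interval (BRight a) (BRight b)] =
   `] 2 * (a - c), 2 * (b - c)]%classic.
  apply/seteqP; split => t /=; rewrite /half_shift !in_itv/=; move=> /andP[h1 h2];
  by apply/andP; split; lra.
rewrite !lebesgue_measure_itv/= !lte_fin.
have -> : (2 * (a - c) < 2 * (b - c)) = (a < b) by rewrite ltr_pM2l// ltrD2r.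
case: ifPn => _; last by rewrite mule0.
by rewrite -!EFinB -EFinM; congr EFin; field.
Qed.

Lemma integral_half_shift c (D : set TR) (f : TR -> \bar R) : measurable D ->
  measurable_fun setT f -> (forall t, 0 <= f t)%E ->
  (\int[lambda]_(t in D) f t =
   (2^-1)%:E * \int[lambda]_(t in half_shift c @^-1` D) f (half_shift c t))%E.
Proof.
move=> mD mf f0.
have mh := @measurable_half_shift c.
unshelve rewrite (@eq_measure_integral _ _ _ D
  (mscale (2^-1 : R)%:nng (pushforward lambda (half_shift c : TR -> TR)))) //;
  last by move=> A mA _; exact: lebesgue_measure_half_shift.
rewrite ge0_integral_mscale//; last exact: measurable_funS mf.
rewrite ge0_integral_pushforward//.
exact: measurable_funS mf.
Qed.

Definition unif01 : probability TR R := uniform_prob (@ltr01 R).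

Lemma integral_unif01_halves (f : TR -> \bar R) :
  measurable_fun setT f -> (forall t, 0 <= f t)%E ->
  (\int[unif01]_t f t =
   (2^-1)%:E * (\int[unif01]_t f (half_shift 0 t) + \int[unif01]_t f (half_shift 2^-1 t)))%E.
Proof.
move=> mf f0; have mfc c : measurable_fun setT (fun t : TR => f (half_shift c t)).
  by apply: measurableT_comp => //; exact: measurable_half_shift.
rewrite !integral_uniform// subr0 invr1 !mul1e.
have I01 : `[0, 1]%classic = `[0, 2^-1[%classic `|` `[2^-1, 1]%classic :> set R.
  by rewrite -itv_bndbnd_setU// bnd_simp; lra.
rewrite [in LHS]I01.
rewrite ge0_integral_setU//=; last 2 first.
- exact: measurable_funS mf.
- rewrite disj_set2E; apply/eqP; rewrite -subset0 => t /=; rewrite !in_itv/=.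
  by move=> -[/andP[_ h1] /andP[h2 _]]; move: h1; rewrite ltNge h2.
rewrite (@integral_half_shift 0 `[0, 2^-1[%classic)//=.
rewrite (@integral_half_shift 2^-1 `[2^-1, 1]%classic)//= [RHS]ge0_muleDr ?integral_ge0//.
congr (_ * _ + _ * _)%E.
- have -> : half_shift 0 @^-1` `[0, 2^-1[%classic = `[0, 1[%classic.
    apply/seteqP; split => t /=; rewrite /half_shift !in_itv/= => /andP[h1 h2];
    by apply/andP; split; lra.
  rewrite -[in RHS]integral_itv_bndo_bndc//; exact: measurable_funS (mfc 0).
- have -> // : half_shift 2^-1 @^-1` `[2^-1, 1]%classic = `[0, 1]%classic.
  apply/seteqP; split => t /=; rewrite /half_shift !in_itv/= => /andP[h1 h2];
  by apply/andP; split; lra.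
Qed.

(** A uniform number is, with equal probabilities, half of a uniform number or that half
    plus 1/2. *)
Lemma mean_unif01_halves (f : TR -> R) : bmeas f ->
  \int[unif01]_t f t =
   2^-1 * (\int[unif01]_t f (half_shift 0 t) + \int[unif01]_t f (half_shift 2^-1 t)).
Proof.
move=> bf; have bfc c : bmeas (fun t : TR => f (half_shift c t)).
  case: bf => mf [M fM]; split; last by exists M.
  by apply: measurableT_comp => //; exact: measurable_half_shift.
case: (bf) => mf [M fM]; pose g t := f t + M.
have g0 t : 0 <= g t.
  by rewrite /g; have := fM t; rewrite ler_norml => /andP[]; lra.
have bg : bmeas g by apply: bmeasD => //; exact: bmeas_cst.
have bgc c : bmeas (fun t : TR => g (half_shift c t)).
  by apply: bmeasD => //; exact: bmeas_cst.
have mg : measurable_fun setT (EFin \o g) by apply/measurable_EFinP; case: bg.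
have g0' t : (0 <= (EFin \o g) t)%E by rewrite lee_fin.
have := integral_unif01_halves mg g0'.
rewrite !mean_EFin// -EFinD -EFinM => -[]; rewrite !meanD ?mean_cst//; try exact: bmeas_cst.
by move=> h; lra.
Qed.

End DyadicMap.

(** * The random point of the Cantor set *)

Lemma continuous_comp_all (R : realType) (f h : R -> R) :
  continuous f -> continuous h -> continuous (h \o f).
Proof. by move=> cf ch x; apply: continuous_comp; [exact: cf | exact: ch]. Qed.

Section LogisticBranch.
Variable R : realType.
Implicit Types (g v w : R) (i : bool).

(** The two inverse branches of x |-> x (1 - x) / g. *)
Definition branch g i v : R := (1 + (-1) ^+ i * Num.sqrt (1 - 4 * g * v)) / 2.

Lemma sqrt_branch g v : 0 < g -> g <= 1 / 8 -> 0 <= v -> v <= 1 ->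
  [/\ 1 / 2 <= Num.sqrt (1 - 4 * g * v), Num.sqrt (1 - 4 * g * v) <= 1
    & Num.sqrt (1 - 4 * g * v) ^+ 2 = 1 - 4 * g * v].
Proof.
move=> g0 g8 v0 v1; have gv0 : 0 <= g * v by rewrite mulr_ge0// ltW.
have gv8 : g * v <= 1 / 8 by rewrite -[leRHS]mulr1 ler_pM// ltW.
have d0 : 0 <= 1 - 4 * g * v by lra.
have s2 := sqr_sqrtr d0; have s0 := sqrtr_ge0 (1 - 4 * g * v).
split => //; first by rewrite leNgt; apply/negP => h; nra.
by rewrite leNgt; apply/negP => h; nra.
Qed.

Lemma branch_itv g i v : 0 < g -> g <= 1 / 8 -> 0 <= v <= 1 -> 0 <= branch g i v <= 1.
Proof.
move=> g0 g8 /andP[v0 v1]; have [h1 h2 _] := sqrt_branch g0 g8 v0 v1.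
by rewrite /branch; case: i; rewrite ?expr0 ?expr1; apply/andP; split; lra.
Qed.

Lemma branch_logistic g i v : 0 < g -> g <= 1 / 8 -> 0 <= v <= 1 ->
  branch g i v * (1 - branch g i v) = g * v.
Proof.
move=> g0 g8 /andP[v0 v1]; have [_ _ h] := sqrt_branch g0 g8 v0 v1.
rewrite /branch; set s := Num.sqrt _ in h *.
have -> : (1 + (-1) ^+ i * s) / 2 * (1 - (1 + (-1) ^+ i * s) / 2)
   = (1 - ((-1) ^+ i) ^+ 2 * s ^+ 2) / 4 by field.
by rewrite sqrr_sign h; field.
Qed.

(** The square root stays above 1/2 as g <= 1/8, so its derivative is small. *)
Lemma branch_contraction g i v w : 0 < g -> g <= 1 / 8 -> 0 <= v <= 1 -> 0 <= w <= 1 ->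
  `|branch g i v - branch g i w| <= 1 / 2 * `|v - w|.
Proof.
move=> g0 g8 /andP[v0 v1] /andP[w0 w1].
have [h1 h2 h3] := sqrt_branch g0 g8 v0 v1.
have [k1 k2 k3] := sqrt_branch g0 g8 w0 w1.
rewrite /branch; set s := Num.sqrt _ in h1 h2 h3 *; set t := Num.sqrt _ in k1 k2 k3 *.
have -> : (1 + (-1) ^+ i * s) / 2 - (1 + (-1) ^+ i * t) / 2 = (-1) ^+ i * ((s - t) / 2) by field.
rewrite normrM normr_sign mul1r normrM.
have e : (s - t) * (s + t) = - (4 * g) * (v - w) by rewrite -subr_sqr h3 k3; ring.
have hst : `|s - t| * (s + t) = 4 * g * `|v - w|.
  have st0 : 0 <= s + t by lra.
  by rewrite -[in LHS](ger0_norm st0) -normrM e normrM normrN (@ger0_norm _ (4 * g)); lra.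
have n0 := normr_ge0 (s - t); have m0 := normr_ge0 (v - w).
have st1 : 1 <= s + t by lra.
rewrite (@ger0_norm _ 2^-1) ?invr_ge0//.
have : `|s - t| * 1 <= `|s - t| * (s + t) by rewrite ler_wpM2l.
have : g * `|v - w| <= 1 / 8 * `|v - w| by rewrite ler_wpM2r.
lra.
Qed.

Lemma continuous_branch g i : continuous (branch g i).
Proof.
move=> v; apply: cvgM; last exact: cvg_cst.
apply: cvgD; first exact: cvg_cst.
apply: cvgM; first exact: cvg_cst.
apply: (@continuous_comp _ _ _ (fun v => 1 - 4 * g * v) (@Num.sqrt R)); last exact: sqrt_continuous.
by apply: cvgB; [exact: cvg_cst | apply: cvgM; [exact: cvg_cst | exact: cvg_id]].
Qed.

End LogisticBranch.

Section CantorPoint.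
Variables (R : realType) (g : nat -> R).
Hypothesis g08 : forall s, 0 < g s <= 1 / 8.
Local Notation TR := (measurableTypeR R).
Local Notation unif := (@unif01 R).

Let g0 s : 0 < g s. Proof. by have /andP[] := g08 s. Qed.
Let g8 s : g s <= 1 / 8. Proof. by have /andP[] := g08 s. Qed.

Definition bit (t : R) : bool := 1 / 2 <= t.

(** The binary digits of t select the branches; the recursion stops at depth m. *)
Fixpoint approx_point m s (t : R) : R :=
  if m is m'.+1 then branch (g s) (bit t) (approx_point m' s.+1 (2 * t - (bit t)%:R)) else 0.

Definition cantor_point s (t : R) : R := limn (fun m => approx_point m s t).

Lemma approx_point_itv m s t : 0 <= approx_point m s t <= 1.
Proof.
elim: m s t => [|m IH] s t /=; first by rewrite lexx ler01.
exact: branch_itv.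
Qed.

Lemma approx_point_cauchy m s t :
  `|approx_point m.+1 s t - approx_point m s t| <= (1 / 2) ^+ m.
Proof.
elim: m s t => [|m IH] s t.
  by have /andP[h1 h2] := approx_point_itv 1 s t; rewrite [approx_point 0 _ _]/= subr0 expr0 ger0_norm.
rewrite [approx_point m.+2 _ _]/= [approx_point m.+1 s t]/=.
apply: le_trans (branch_contraction _ _ _ _ _) _ => //; try exact: approx_point_itv.
  exact: (approx_point_itv m.+1).
by rewrite exprS ler_wpM2l// ?IH//; lra.
Qed.

Lemma cvg_approx_point s t : approx_point m s t @[m --> \oo] --> cantor_point s t.
Proof.
suff : cvgn (fun m => approx_point m s t) by [].
pose u := fun m => approx_point m s t : R.
have -> : (fun m => approx_point m s t) = (fun m => u 0 + series (telescope u) m).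
  by apply/funext => m; rewrite -eq_sum_telescope.
apply: is_cvgD; first exact: is_cvg_cst.
apply: normed_cvg; apply: (@series_le_cvg _ _ (geometric 1 (1 / 2))) => [n|n|n|].
- exact: normr_ge0.
- by apply: geometric_ge0; lra.
- by rewrite /geometric/= mul1r /telescope; exact: approx_point_cauchy.
- by apply: is_cvg_geometric_series; rewrite ger0_norm; lra.
Qed.

Lemma cantor_point_itv s t : 0 <= cantor_point s t <= 1.
Proof.
apply/andP; split.
- apply: limr_ge; first exact: cvg_approx_point.
  by apply: nearW => m; have /andP[] := approx_point_itv m s t.
- apply: limr_le; first exact: cvg_approx_point.
  by apply: nearW => m; have /andP[] := approx_point_itv m s t.
Qed.

Lemma cantor_pointE s t :
  cantor_point s t = branch (g s) (bit t) (cantor_point s.+1 (2 * t - (bit t)%:R)).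
Proof.
have h1 : approx_point m.+1 s t @[m --> \oo] --> cantor_point s t.
  by have := @cvg_approx_point s t; rewrite -cvg_shiftS.
have h2 : approx_point m.+1 s t @[m --> \oo] -->
    branch (g s) (bit t) (cantor_point s.+1 (2 * t - (bit t)%:R)).
  have c1 := @cvg_approx_point s.+1 (2 * t - (bit t)%:R).
  exact: (cvg_comp _ _ c1 (@continuous_branch _ (g s) (bit t) _)).
by rewrite -(cvg_lim _ h1)// (cvg_lim _ h2).
Qed.

Lemma measurable_bit : measurable_fun setT (bit : TR -> bool).
Proof. by apply: measurable_fun_ler; [exact: measurable_cst | exact: measurable_id]. Qed.

Lemma measurable_approx_point m s : measurable_fun setT (approx_point m s : TR -> R).
Proof.
elim: m s => [|m IH] s; first exact: measurable_cst.
have h i : measurable_fun setT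
    (fun t : TR => branch (g s) i (approx_point m s.+1 (2 * t - i%:R))).
  apply: (@measurableT_comp _ _ _ TR TR TR (branch (g s) i : TR -> TR)).
    exact: (continuous_measurable_fun (@continuous_branch _ (g s) i)).
  apply: measurableT_comp; first exact: IH.
  apply: measurable_funB; last exact: measurable_cst.
  by apply: measurable_funM; [exact: measurable_cst | exact: measurable_id].
have -> : approx_point m.+1 s = (fun t : TR => if bit t
   then branch (g s) true (approx_point m s.+1 (2 * t - true%:R))
   else branch (g s) false (approx_point m s.+1 (2 * t - false%:R))).
  by apply/funext => t /=; case: (bit t).
apply: measurable_fun_ifT; [exact: measurable_bit | exact: (h true) | exact: (h false)].
Qed.

Lemma bmeas_cantor_point s : bmeas (cantor_point s : TR -> R).
Proof.
split; last first.
  exists 1 => t; have /andP[h1 h2] := cantor_point_itv s t.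
  by rewrite ger0_norm.
apply: (@measurable_fun_cvg _ _ _ _ (fun m => approx_point m s)).
  by move=> m; exact: measurable_approx_point.
by move=> t _; exact: cvg_approx_point.
Qed.

Lemma eq_mean_unif01 (f h : TR -> R) : bmeas f -> bmeas h ->
  (forall t, 0 <= t < 1 -> f t = h t) -> \int[unif]_t f t = \int[unif]_t h t.
Proof.
move=> bf bh fh; rewrite /Rintegral; congr fine.
apply: ae_eq_integral => //.
- by apply/measurable_EFinP; case: bf.
- by apply/measurable_EFinP; case: bh.
exists (~` `[0, 1[%classic); split.
- exact: measurableC.
- rewrite /unif01 /uniform_prob [LHS]integral_uniform_pdf.
  have -> : ~` `[0, 1[%classic `&` `[0, 1]%classic = [set 1] :> set R.
    apply/seteqP; split => [t [/= h1 h2]|t ->/=].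
      apply/eqP; rewrite eq_le; move: h1 h2; rewrite !in_itv/= => /negP.
      by rewrite negb_and -ltNge -leNgt => /orP[k|->] /andP[k' ->]//; lra.
    by rewrite !in_itv/= ltxx andbF ler01 lexx; split.
  exact: integral_set1.
- by move=> t /= ht h01; apply: ht => _; rewrite fh//; move: h01; rewrite in_itv.
Qed.

(** The first digit of a uniform number is a fair coin independent of the others, so the
    first branch is chosen fairly and the remaining ones have the law of the next level. *)
Lemma mean_cantor_point s (f : R -> R) : continuous f ->
  \int[unif]_t f (cantor_point s t) =
  2^-1 * (\int[unif]_t f (branch (g s) false (cantor_point s.+1 t))
        + \int[unif]_t f (branch (g s) true (cantor_point s.+1 t))).
Proof.
move=> cf; have bh := bmeas_comp cf (bmeas_cantor_point s).
rewrite mean_unif01_halves//; congr (_ * (_ + _)).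
- apply: eq_mean_unif01 => [||t /andP[t0 t1]].
  + by case: bh => mh [M hM]; split; [exact: (measurableT_comp mh (@measurable_half_shift _ _))|exists M => t; exact: hM].
  + exact: (bmeas_comp (continuous_comp_all (@continuous_branch _ (g s) false) cf) (bmeas_cantor_point s.+1)).
  have b : bit (half_shift 0 t) = false.
    by apply/negbTE; rewrite -ltNge /half_shift; lra.
  rewrite cantor_pointE b (_ : 2 * _ - _ = t)//.
  by rewrite /half_shift ?mulr0n ?mulr1n; field.
- apply: eq_mean_unif01 => [||t /andP[t0 t1]].
  + by case: bh => mh [M hM]; split; [exact: (measurableT_comp mh (@measurable_half_shift _ _))|exists M => t; exact: hM].
  + exact: (bmeas_comp (continuous_comp_all (@continuous_branch _ (g s) true) cf) (bmeas_cantor_point s.+1)).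
  have b : bit (half_shift 2^-1 t) by rewrite /bit /half_shift; lra.
  rewrite cantor_pointE b (_ : 2 * _ - _ = t)//.
  by rewrite /half_shift ?mulr0n ?mulr1n; field.
Qed.

End CantorPoint.

(** * The potential of the random point *)

Section KlogPair.
Variable R : realType.
Implicit Types (e d g v w x : R).

Lemma sqr_le1 d : -1 <= d <= 1 -> d ^+ 2 <= 1.
Proof.
move=> /andP[d0 d1]; have : 0 <= (1 - d) * (1 + d) by rewrite mulr_ge0//; lra.
lra.
Qed.

Lemma reglog_sum_expand g e d : 0 < g -> 0 < e ->
  - ln g + reglog e d = - (1 / 2) * ln (g ^+ 2 * (d ^+ 2 + e ^+ 2)).
Proof.
move=> g0 e0; rewrite /reglog lnM ?posrE ?exprn_gt0 ?ltr_wpDl ?sqr_ge0 ?exprn_gt0//.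
by rewrite lnXn// -[ln g *+ 2]mulr_natl; lra.
Qed.

Lemma reglogD e d d' : 0 < e -> reglog e d + reglog e d' =
  - (1 / 2) * ln ((d ^+ 2 + e ^+ 2) * (d' ^+ 2 + e ^+ 2)).
Proof.
by move=> e0; rewrite /reglog lnM ?posrE ?ltr_wpDl ?sqr_ge0 ?exprn_gt0// -mulrDr.
Qed.

Lemma reglog_le e d : 0 < e -> reglog e d <= - ln e.
Proof.
move=> e0; have -> : - ln e = - (1 / 2) * ln (e ^+ 2) by rewrite lnXn// -[ln e *+ 2]mulr_natl; lra.
rewrite /reglog ler_nM2l; last by lra.
by rewrite ler_ln ?posrE ?ltr_wpDl ?sqr_ge0 ?exprn_gt0// lerDr sqr_ge0.
Qed.

Lemma reglog_ge e d : 0 < e -> e <= 1 -> -1 <= d <= 1 -> -1 <= reglog e d.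
Proof.
move=> e0 e1 /sqr_le1 d2.
have e2 : e ^+ 2 <= 1 by rewrite exprn_ile1// ltW.
have h : 0 < d ^+ 2 + e ^+ 2 by rewrite ltr_wpDl ?sqr_ge0 ?exprn_gt0.
have := @le_ln1Dx R (d ^+ 2 + e ^+ 2 - 1); rewrite /reglog.
have -> : 1 + (d ^+ 2 + e ^+ 2 - 1) = d ^+ 2 + e ^+ 2 by ring.
have -> : -1 < d ^+ 2 + e ^+ 2 - 1 by lra.
by move=> /(_ isT); lra.
Qed.

(** Multiplying out, the left side is - 1/2 times the logarithm of
    g^2 (v - w)^2 + e^2 ((x - y)^2 + (x - y')^2) + e^4, where the preimages y, y' of w are
    at distance at least 1/sqrt 2, so the coefficient of e^2 exceeds g^2. *)
Lemma reglog_branch_le g e v w x : 0 < g -> g <= 1 / 8 -> 0 < e -> 0 <= w <= 1 ->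
  x * (1 - x) = g * v ->
  reglog e (x - branch g false w) + reglog e (x - branch g true w) <=
  - ln g + reglog e (v - w).
Proof.
move=> g0 g8 e0 w01 xv; have yw := branch_logistic false g0 g8 w01.
have -> : branch g true w = 1 - branch g false w.
  by rewrite /branch expr0 expr1; field.
move: (branch g false w) yw => y yw; case/andP: w01 => w0 w1.
rewrite reglogD// reglog_sum_expand// ler_nM2l; last by lra.
have e2 : 0 < e ^+ 2 by rewrite exprn_gt0.
have p0 d : 0 < d ^+ 2 + e ^+ 2 by rewrite ltr_wpDl ?sqr_ge0.
rewrite ler_ln ?posrE ?mulr_gt0 ?exprn_gt0//.
have gw : g * w <= 1 / 8 by rewrite -[leRHS]mulr1 ler_pM// ltW.
have g2 : g ^+ 2 <= 1 / 64.
  have : 0 <= (1 / 8 - g) * (1 / 8 + g) by rewrite mulr_ge0//; lra.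
  lra.
have -> : ((x - y) ^+ 2 + e ^+ 2) * ((x - (1 - y)) ^+ 2 + e ^+ 2) =
  (x * (1 - x) - y * (1 - y)) ^+ 2
   + e ^+ 2 * ((2 * x - 1) ^+ 2 + (1 - 4 * (y * (1 - y)))) / 2 + e ^+ 2 * e ^+ 2.
  by field.
rewrite xv yw.
have s0 := sqr_ge0 (2 * x - 1).
have h : 0 <= e ^+ 2 * ((2 * x - 1) ^+ 2 + (1 - 4 * (g * w)) - 2 * g ^+ 2).
  apply: mulr_ge0; first exact: ltW.
  lra.
have h' : 0 < e ^+ 2 * e ^+ 2 by rewrite mulr_gt0.
have -> : g ^+ 2 * ((v - w) ^+ 2 + e ^+ 2) = (g * v - g * w) ^+ 2 + e ^+ 2 * g ^+ 2 by ring.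
lra.
Qed.

(** The same product, now with (x - y)^2 + (x - y')^2 + e^2 <= 3; the loss is absorbed by
    enlarging e by the factor 2 / g. *)
Lemma reglog_branch_ge g e v w x : 0 < g -> g <= 1 / 8 -> 0 < e -> e <= 1 ->
  0 <= w <= 1 -> 0 <= x <= 1 -> x * (1 - x) = g * v ->
  - ln g + reglog (2 * e / g) (v - w) <=
  reglog e (x - branch g false w) + reglog e (x - branch g true w).
Proof.
move=> g0 g8 e0 e1 w01 /andP[x0 x1] xv; have yw := branch_logistic false g0 g8 w01.
have /andP[y0 y1] := branch_itv false g0 g8 w01.
have -> : branch g true w = 1 - branch g false w.
  by rewrite /branch expr0 expr1; field.
move: (branch g false w) y0 y1 yw => y y0 y1 yw.
have eg : 0 < 2 * e / g by rewrite divr_gt0// mulr_gt0.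
rewrite reglogD// reglog_sum_expand// ler_nM2l; last by lra.
have e2 : 0 < e ^+ 2 by rewrite exprn_gt0.
have p0 d : 0 < d ^+ 2 + e ^+ 2 by rewrite ltr_wpDl ?sqr_ge0.
have q0 d : 0 < d ^+ 2 + (2 * e / g) ^+ 2 by rewrite ltr_wpDl ?sqr_ge0 ?exprn_gt0.
rewrite ler_ln ?posrE ?mulr_gt0 ?exprn_gt0//.
have -> : g ^+ 2 * ((v - w) ^+ 2 + (2 * e / g) ^+ 2) = (g * v - g * w) ^+ 2 + 4 * e ^+ 2.
  by field; rewrite lt0r_neq0.
have -> : ((x - y) ^+ 2 + e ^+ 2) * ((x - (1 - y)) ^+ 2 + e ^+ 2) =
  (x * (1 - x) - y * (1 - y)) ^+ 2
   + e ^+ 2 * ((x - y) ^+ 2 + (x - (1 - y)) ^+ 2 + e ^+ 2).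
  by ring.
rewrite xv yw lerD2l [leRHS]mulrC ler_wpM2l ?ltW//.
have h1 : (x - y) ^+ 2 <= 1 by apply: sqr_le1; lra.
have h2 : (x - (1 - y)) ^+ 2 <= 1 by apply: sqr_le1; lra.
have h3 : e ^+ 2 <= 1 by rewrite exprn_ile1// ltW.
lra.
Qed.

End KlogPair.

Section Potential.
Variables (R : realType) (g V : nat -> R).
Hypothesis g08 : forall s, 0 < g s <= 1 / 8.
Hypothesis Vrec : forall s, 2 * V s = - ln (g s) + V s.+1.
Hypothesis V0 : forall s, 0 <= V s.
Hypothesis Vlim : forall eps : R, 0 < eps -> exists m, (V m + 1) * (1 / 2) ^+ m < eps.
Local Notation unif := (@unif01 R).
Local Notation cp := (cantor_point g).

Let g0 s : 0 < g s. Proof. by have /andP[] := g08 s. Qed.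
Let g8 s : g s <= 1 / 8. Proof. by have /andP[] := g08 s. Qed.

Fixpoint logistic_orbit m s (x : R) : R :=
  if m is m'.+1 then logistic_orbit m' s.+1 (x * (1 - x) / g s) else x.

Definition Kreal s : set R := [set x | forall m, 0 <= logistic_orbit m s x <= 1].

Lemma Kreal_itv s x : Kreal s x -> 0 <= x <= 1.
Proof. by move=> /(_ 0). Qed.

Lemma Kreal_step s x : Kreal s x -> Kreal s.+1 (x * (1 - x) / g s).
Proof. by move=> Kx m; have := Kx m.+1. Qed.

Lemma cantor_point_logistic s t : exists t',
  cp s t * (1 - cp s t) / g s = cp s.+1 t'.
Proof.
exists (2 * t - (bit t)%:R); rewrite cantor_pointE// branch_logistic//; last exact: cantor_point_itv.
by rewrite mulrAC mulfV ?mul1r// lt0r_neq0.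
Qed.

Lemma cantor_point_Kreal s t : Kreal s (cp s t).
Proof.
move=> m; elim: m s t => [|m IH] s t /=; first exact: cantor_point_itv.
by have [t' ->] := cantor_point_logistic s t.
Qed.

(** The smoothed logarithmic potential, at x, of the random point of level s. *)
Definition reg_potential (e : R) s (x : R) : R := \int[unif]_t reglog e (x - cp s t).

Let bmeas_potential_kernel (e : R) s x : 0 < e -> bmeas (fun t : measurableTypeR R => reglog e (x - cp s t)).
Proof.
move=> e0; apply: bmeas_reglog => //; apply: bmeasB; first exact: bmeas_cst.
exact: bmeas_cantor_point.
Qed.

Let bmeas_branch_kernel (e : R) s x i : 0 < e ->
  bmeas (fun t : measurableTypeR R => reglog e (x - branch (g s) i (cp s.+1 t))).
Proof.
move=> e0; apply: bmeas_reglog => //; apply: bmeasB; first exact: bmeas_cst.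
exact: (bmeas_comp (@continuous_branch _ (g s) i) (bmeas_cantor_point g08 s.+1)).
Qed.

Let reg_potential_branch (e : R) s x : 0 < e ->
  reg_potential e s x = 2^-1 * \int[unif]_t
    (reglog e (x - branch (g s) false (cp s.+1 t)) + reglog e (x - branch (g s) true (cp s.+1 t))).
Proof.
move=> e0; have bb i := bmeas_branch_kernel s x i e0.
have cf : continuous (fun y => reglog e (x - y)).
  apply: (@continuous_comp_all _ (fun y => x - y) (reglog e)); last exact: continuous_reglog.
  by move=> y; apply: cvgB; [exact: cvg_cst | exact: cvg_id].
by rewrite /reg_potential (mean_cantor_point g08 s cf) -meanD.
Qed.

Lemma reg_potential_le_step (e : R) s x : 0 < e -> 
  reg_potential e s x <= 2^-1 * (- ln (g s) + reg_potential e s.+1 (x * (1 - x) / g s)).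
Proof.
move=> e0; rewrite reg_potential_branch// ler_pM2l ?invr_gt0//.
rewrite /reg_potential -[X in X + _](mean_cst unif) -meanD; [|exact: bmeas_cst|exact: bmeas_potential_kernel].
have bb i := bmeas_branch_kernel s x i e0.
apply: le_mean.
- by apply: bmeasD; [exact: (bb false) | exact: (bb true)].
- by apply: bmeasD; [exact: bmeas_cst | exact: bmeas_potential_kernel].
move=> t; apply: reglog_branch_le => //; first exact: cantor_point_itv.
by rewrite [RHS]mulrC divfK// lt0r_neq0.
Qed.

Lemma reg_potential_ge_step (e : R) s x : 0 < e -> e <= 1 -> 0 <= x <= 1 ->
  2^-1 * (- ln (g s) + reg_potential (2 * e / g s) s.+1 (x * (1 - x) / g s)) <= reg_potential e s x.
Proof.
move=> e0 e1 x01; rewrite (reg_potential_branch _ _ e0) ler_pM2l ?invr_gt0//.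
have eg : 0 < 2 * e / g s by rewrite divr_gt0// mulr_gt0.
rewrite /reg_potential -[X in X + _](mean_cst unif) -meanD; [|exact: bmeas_cst|exact: bmeas_potential_kernel].
have bb i := bmeas_branch_kernel s x i e0.
apply: le_mean.
- by apply: bmeasD; [exact: bmeas_cst | exact: bmeas_potential_kernel].
- by apply: bmeasD; [exact: (bb false) | exact: (bb true)].
move=> t; apply: reglog_branch_ge => //; first exact: cantor_point_itv.
by rewrite [RHS]mulrC divfK// lt0r_neq0.
Qed.

(** Each step halves the excess of the potential over V, and the kernel is bounded by
    - ln e from the start. *)
Lemma reg_potential_le (e : R) s x : 0 < e -> e <= 1 -> Kreal s x -> reg_potential e s x <= V s.
Proof.
move=> e0 e1.
have step m : forall s x, Kreal s x -> reg_potential e s x - V s <= - ln e * (1 / 2) ^+ m.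
  elim: m => [|m IH] {s x} s x Kx.
    rewrite expr0 mulr1 (@le_trans _ _ (reg_potential e s x))//; first by rewrite gerBl V0.
    by apply: mean_le => [|t]; [exact: bmeas_potential_kernel | exact: reglog_le].
  have h1 := reg_potential_le_step s x e0; have h2 := IH _ _ (Kreal_step Kx).
  have h3 := Vrec s; rewrite exprS; lra.
move=> Kx; rewrite leNgt; apply/negP; rewrite -subr_gt0 => h.
have q0 : 0 <= 1 / 2 :> R by lra.
have q1 : 1 / 2 < 1 :> R by lra.
have [m hm] := geometric_lt (- ln e) q0 q1 h.
by have := step m s x Kx; lra.
Qed.

(** After m steps the scale e has only grown by a constant factor, so for e small it is
    still at most 1 and the kernel is at least - 1; the defect has been divided by 2^m. *)
Lemma reg_potential_ge (eta : R) : 0 < eta -> exists2 e0 : R, 0 < e0 <= 1 &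
  forall e x : R, 0 < e -> e <= e0 -> Kreal 0 x -> V 0 - eta <= reg_potential e 0 x.
Proof.
move=> eta0.
have step m : forall s, exists2 e0 : R, 0 < e0 <= 1 & forall e x : R, 0 < e -> e <= e0 ->
    Kreal s x -> V s - (V (s + m) + 1) * (1 / 2) ^+ m <= reg_potential e s x.
  elim: m => [|m IH] s.
    exists 1 => [|e x e0 e1 Kx]; first by rewrite ltr01 lexx.
    rewrite addn0 expr0 mulr1 opprD addNKr.
    apply: le_mean_cst => [|t]; first exact: bmeas_potential_kernel.
    apply: reglog_ge => //; have /andP[? ?] := Kreal_itv Kx.
    by have /andP[? ?] := cantor_point_itv g08 s t; apply/andP; split; lra.
  have [e1 /andP[e10 e11] he1] := IH s.+1.
  exists (Num.min 1 (e1 * g s / 2)).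
    by rewrite ge_min lexx andbT lt_min ltr01/= divr_gt0// mulr_gt0.
  move=> e x e0; rewrite le_min => /andP[el1 el2] Kx.
  have h1 := reg_potential_ge_step s e0 el1 (Kreal_itv Kx).
  have h3 := Vrec s; rewrite exprS -addSnnS.
  have : V s.+1 - (V (s.+1 + m) + 1) * (1 / 2) ^+ m <= reg_potential (2 * e / g s) s.+1 (x * (1 - x) / g s).
    apply: he1; [by rewrite divr_gt0// mulr_gt0| |exact: Kreal_step].
    by rewrite ler_pdivrMr//; lra.
  lra.
have [m hm] := Vlim eta0; have [e0 he0 H] := step m 0%N.
exists e0 => // e x e1 ee0 Kx; have := H e x e1 ee0 Kx; rewrite add0n; lra.
Qed.

End Potential.

(** * Lower bounds for L2 norms of polynomials *)

Section LinearComposition.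
Variables (R : realType) (a b : R).

Let l : {poly R} := b *: 'X + a%:P.

Let size_l : (size l <= 2)%N.
Proof.
rewrite (leq_trans (size_polyD _ _))// geq_max (leq_trans (size_scale_leq _ _)) ?size_polyX//.
by rewrite (leq_trans (size_polyC_leq1 _)).
Qed.

Let size_exp_l n : (size (l ^+ n) <= n.+1)%N.
Proof.
rewrite (leq_trans (size_poly_exp_leq _ _))// ltnS -[leqRHS]mul1n leq_mul2r.
by rewrite -subn1 leq_subLR size_l orbT.
Qed.

Let coef_exp_l n : (l ^+ n)`_n = b ^+ n.
Proof.
elim: n => [|n IH]; first by rewrite !expr0 coefC.
rewrite exprS /l mulrDl coefD -scalerAl coefZ coefXM/= mul_polyC coefZ -/l IH exprS.
by rewrite [X in a * X]nth_default ?mulr0 ?addr0.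
Qed.

Lemma size_comp_linear (p : {poly R}) n : (size p <= n.+1)%N ->
  (size (p \Po (b *: 'X + a%:P)) <= n.+1)%N.
Proof.
move=> pn; rewrite (leq_trans (size_comp_poly_leq _ _))// ltnS -[leqRHS]muln1 leq_mul//.
  by rewrite -subn1 leq_subLR add1n.
by rewrite -subn1 leq_subLR.
Qed.

Lemma coef_comp_linear (p : {poly R}) n : (size p <= n.+1)%N ->
  (p \Po (b *: 'X + a%:P))`_n = p`_n * b ^+ n.
Proof.
move=> pn; have {1}-> : p = \poly_(i < n.+1) p`_i.
  apply/polyP => i; rewrite coef_poly; case: ltnP => // ni.
  by rewrite nth_default// (leq_trans pn).
rewrite -/l poly_def (raddf_sum (comp_poly l)) coef_sum big_ord_recr/= big1 ?add0r => [|i _].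
  by rewrite linearZ/= comp_Xn_poly coefZ coef_exp_l.
rewrite linearZ/= comp_Xn_poly coefZ [(l ^+ i)`_n]nth_default ?mulr0//.
by rewrite (leq_trans (size_exp_l _)).
Qed.

End LinearComposition.

Section L2Bound.
Variables (R : realType) (g V : nat -> R).
Hypothesis g08 : forall s, 0 < g s <= 1 / 8.
Hypothesis Vrec : forall s, 2 * V s = - ln (g s) + V s.+1.
Hypothesis V8 : forall s, ln 8 <= V s.
Local Notation unif := (@unif01 R).
Local Notation cp := (cantor_point g).

Let g0 s : 0 < g s. Proof. by have /andP[] := g08 s. Qed.
Let g8 s : g s <= 1 / 8. Proof. by have /andP[] := g08 s. Qed.

(* [p] expanded in the variable [y] where [x = (1 + y) / 2] *)
Let centred (p : {poly R}) := p \Po ((1 / 2) *: 'X + (1 / 2)%:P).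
Let rescale s (p : {poly R}) := p \Po ((- (4 * g s)) *: 'X + 1%:P).
Let evp s p := rescale s (even_poly (centred p)).
Let odp s p := rescale s (odd_poly (centred p)).

Let horner_centred_branch s i v (p : {poly R}) : 0 <= v <= 1 ->
  p.[branch (g s) i v] =
    (evp s p).[v] + (-1) ^+ i * Num.sqrt (1 - 4 * g s * v) * (odp s p).[v].
Proof.
move=> /andP[v0 v1]; have [_ _ r2] := sqrt_branch (g0 s) (g8 s) v0 v1.
set r := Num.sqrt _ in r2 *.
have -> : p.[branch (g s) i v] = (centred p).[(-1) ^+ i * r].
  rewrite /centred horner_comp !(hornerD, hornerZ, hornerX, hornerC) /branch -/r.
  by congr (_.[_]); move: ((-1) ^+ i) => u; field.
rewrite -[centred p in LHS]poly_even_odd hornerD hornerM hornerX !horner_comp hornerXn.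
rewrite !(hornerD, hornerZ, hornerX, hornerC).
have -> : ((-1) ^+ i * r) ^+ 2 = - (4 * g s) * v + 1.
  by rewrite exprMn sqrr_sign r2; ring.
by rewrite [_ * (_ * r)]mulrC.
Qed.

(** The two branches differ by the sign of y = 2 x - 1, so the cross terms of the square
    cancel, while y^2 = 1 - 4 g v depends on the logistic image v only. *)
Lemma mean_sqr_cantor_point s (p : {poly R}) :
  \int[unif]_t (p.[cp s t] ^+ 2) =
  \int[unif]_t ((evp s p).[cp s.+1 t] ^+ 2
     + (1 - 4 * g s * cp s.+1 t) * (odp s p).[cp s.+1 t] ^+ 2).
Proof.
have cf : continuous (fun y => p.[y] ^+ 2).
  have -> : (fun y => p.[y] ^+ 2) = horner (p ^+ 2) by apply/funext => y; rewrite horner_exp.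
  exact: continuous_horner.
rewrite (mean_cantor_point g08 s cf).
have bb i : bmeas (fun t : measurableTypeR R => p.[branch (g s) i (cp s.+1 t)] ^+ 2).
  apply: bmeasX; apply: bmeas_horner.
  exact: (bmeas_comp (@continuous_branch _ (g s) i) (bmeas_cantor_point g08 s.+1)).
rewrite -meanD// -meanZ; last by apply: bmeasD; [exact: (bb false)|exact: (bb true)].
apply: eq_Rintegral => t _ /=; have h := cantor_point_itv g08 s.+1 t.
rewrite !horner_centred_branch//; move/andP: h => [v0 v1].
have [_ _ r2] := sqrt_branch (g0 s) (g8 s) v0 v1.
by move: (Num.sqrt _) r2 => r r2; rewrite -r2 [(-1) ^+ false]expr0 [(-1) ^+ true]expr1; field.
Qed.

(** If n = 2 m the even part alone has the right size, and if n = 2 m + 1 the odd part: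
    the factor 1 - 4 g v >= 1/2 and the coefficient 1/2 of y in x cost 1/8, which is
    compensated by exp (- 2 V s) <= 1/64. *)
Lemma mean_sqr_ge s n j (p : {poly R}) : (0 < n)%N -> j = trunc_log 2 n ->
  (size p <= n.+1)%N ->
  p`_n ^+ 2 * (expR (- (2 * n%:R * V s)) * (expR (2 * V (s + j)) / 8))
    <= \int[unif]_t (p.[cp s t] ^+ 2).
Proof.
have bh s' (q : {poly R}) : bmeas (fun t : measurableTypeR R => q.[cp s' t] ^+ 2).
  by apply: bmeasX; apply: bmeas_horner; exact: bmeas_cantor_point.
elim/ltn_ind: n s j p => n IH s j p n0 jE pn.
have bw s' : bmeas (fun t : measurableTypeR R => 1 - 4 * g s * cp s' t).
  by apply: bmeasB; [exact: bmeas_cst | apply: bmeasZ; exact: bmeas_cantor_point].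
have cn : (size (centred p) <= n.+1)%N by exact: size_comp_linear.
have cc : (centred p)`_n = p`_n * (1 / 2) ^+ n by exact: coef_comp_linear.
rewrite mean_sqr_cantor_point.
have Vs := Vrec s; have g1 := g8 s; have V1 := V8 s; have gg := g0 s.
have mod2 := odd_double_half n; set m := n./2 in mod2.
have m2g : g s ^+ m.*2 * expR (- (2 * m%:R * V s.+1)) = expR (- (2 * m.*2%:R * V s)).
  have -> : g s ^+ m.*2 = expR (m.*2%:R * ln (g s)).
    by rewrite mulrC expRM_natr lnK// posrE.
  rewrite -expRD; congr expR; rewrite -muln2 natrM.
  have -> : ln (g s) = V s.+1 - 2 * V s by lra.
  ring.
have pow4 : (1 / 2) ^+ m.*2 * (- (4 * g s)) ^+ m = (- g s) ^+ m.
  by rewrite -mul2n exprM -exprMn; congr (_ ^+ _); field.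
have sqr_pow : ((- g s) ^+ m) ^+ 2 = g s ^+ m.*2.
  by rewrite -exprM mulnC exprM sqrrN -exprM mul2n.
have e8 : 8 <= expR (2 * V s).
  have h8 : 1 <= expR (V s) by rewrite -expR0 ler_expR (le_trans _ V1)// ln_ge0//; lra.
  have : 8 <= expR (V s) by rewrite -[leLHS]lnK ?posrE// ler_expR.
  by rewrite mulr2n mulrDl mul1r expRD; nra.
have evb := bh s.+1 (evp s p); have odb := bh s.+1 (odp s p).
have odd_ge0 v : 0 <= v <= 1 -> 1 / 2 <= 1 - 4 * g s * v.
  move=> /andP[v0 v1]; have : g s * v <= 1 / 8 * 1 by rewrite ler_pM// ltW.
  lra.
have bo : bmeas (fun t : measurableTypeR R => (1 - 4 * g s * cp s.+1 t) * (odp s p).[cp s.+1 t] ^+ 2).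
  exact: bmeasM.
case: (boolP (odd n)) => on; rewrite ?on ?(negbTE on) in mod2.
- have hO : (1 / 2) * \int[unif]_t ((odp s p).[cp s.+1 t] ^+ 2) <=
     \int[unif]_t ((evp s p).[cp s.+1 t] ^+ 2
     + (1 - 4 * g s * cp s.+1 t) * (odp s p).[cp s.+1 t] ^+ 2).
    rewrite -meanZ//; apply: le_mean; [exact: bmeasZ | exact: bmeasD |] => t.
    rewrite (@le_trans _ _ ((1 - 4 * g s * cp s.+1 t) * (odp s p).[cp s.+1 t] ^+ 2))//.
      by rewrite ler_wpM2r ?sqr_ge0// odd_ge0// cantor_point_itv.
    by rewrite lerDr sqr_ge0.
  apply: le_trans hO.
  have so : (size (odd_poly (centred p)) <= m.+1)%N.
    rewrite (leq_trans (size_odd_poly _))// (leq_trans (half_leq cn))//.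
    by rewrite -mod2 add1n /= doubleK.
  have so' : (size (odp s p) <= m.+1)%N by exact: size_comp_linear.
  have co : (odp s p)`_m ^+ 2 = p`_n ^+ 2 / 4 * g s ^+ m.*2.
    rewrite /odp /rescale coef_comp_linear// coef_odd_poly.
    have -> : m.*2.+1 = n by rewrite -mod2.
    have powodd : (1 / 2) ^+ n * (- (4 * g s)) ^+ m = 1 / 2 * (- g s) ^+ m.
      by rewrite -{1}mod2 add1n exprS -mulrA pow4.
    by rewrite cc -mulrA powodd 2!exprMn sqr_pow; field.
  have [m0|m0] := posnP m.
    have n1 : n = 1%N by rewrite -mod2 m0.
    have -> : \int[unif]_t ((odp s p).[cp s.+1 t] ^+ 2) = (odp s p)`_m ^+ 2.
      rewrite -[RHS](mean_cst unif); apply: eq_Rintegral => t _.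
      have /size1_polyC -> : (size (odp s p) <= 1)%N by rewrite m0 in so'.
      by rewrite m0 hornerC coefC.
    rewrite co m0 expr0 mulr1 jE n1 trunc_log1 addn0 mulr1 mulrA -expRD addrC subrr expR0.
    lra.
  have mn : (m < n)%N by rewrite -mod2 add1n ltnS -addnn leq_addr.
  have IHm := IH m mn s.+1 _ (odp s p) m0 (erefl _) so'.
  have jm : j = (trunc_log 2 m).+1.
    by rewrite jE -/m trunc_log2S// -mod2 add1n ltnS double_gt0.
  rewrite co in IHm; rewrite jm addnS -addSn.
  apply: (@le_trans _ _ (1 / 2 * (p`_n ^+ 2 / 4 * g s ^+ m.*2 *
      (expR (- (2 * m%:R * V s.+1)) * (expR (2 * V (s.+1 + trunc_log 2 m)) / 8))))); last first.
    by rewrite ler_pM2l//; lra.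
  set W := expR (2 * V (_ + _)).
  have -> : expR (- (2 * n%:R * V s)) =
      g s ^+ m.*2 * expR (- (2 * m%:R * V s.+1)) * expR (- (2 * V s)).
    by rewrite m2g -expRD -{1}mod2 add1n -natr1; congr expR; ring.
  set Z := expR (- (2 * m%:R * _)); set G := g s ^+ _.
  have W0 : 0 <= p`_n ^+ 2 * (G * Z * W).
    by rewrite mulr_ge0 ?sqr_ge0// !mulr_ge0 ?expR_ge0// exprn_ge0// ltW.
  have e8' : expR (- (2 * V s)) <= 1 / 8.
    by rewrite expRN div1r lef_pV2 ?posrE ?expR_gt0.
  have : p`_n ^+ 2 * (G * Z * W) * expR (- (2 * V s)) <= p`_n ^+ 2 * (G * Z * W) * (1 / 8).
    by rewrite ler_wpM2l.
  by lra.
- have hE : \int[unif]_t ((evp s p).[cp s.+1 t] ^+ 2) <=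
     \int[unif]_t ((evp s p).[cp s.+1 t] ^+ 2
     + (1 - 4 * g s * cp s.+1 t) * (odp s p).[cp s.+1 t] ^+ 2).
    apply: le_mean => //; first exact: bmeasD.
    move=> t; rewrite lerDl mulr_ge0 ?sqr_ge0//.
    by have := odd_ge0 _ (cantor_point_itv g08 s.+1 t); lra.
  apply: le_trans hE; rewrite add0n in mod2.
  have se : (size (even_poly (centred p)) <= m.+1)%N.
    by rewrite (leq_trans (size_even_poly _))// (leq_trans (uphalf_leq cn)).
  have se' : (size (evp s p) <= m.+1)%N by exact: size_comp_linear.
  have ce : (evp s p)`_m ^+ 2 = p`_n ^+ 2 * g s ^+ m.*2.
    rewrite /evp /rescale coef_comp_linear// coef_even_poly mod2 cc -mulrA.
    have -> : (1 / 2) ^+ n * (- (4 * g s)) ^+ m = (- g s) ^+ m by rewrite -{1}mod2 pow4.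
    by rewrite exprMn sqr_pow mod2.
  have m0 : (0 < m)%N by rewrite -double_gt0 mod2.
  have mn : (m < n)%N by rewrite -mod2 -addnn -[ltnLHS]addn0 ltn_add2l.
  have IHm := IH m mn s.+1 _ (evp s p) m0 (erefl _) se'.
  have jm : j = (trunc_log 2 m).+1 by rewrite jE -mod2 trunc_log2_double.
  rewrite jm addnS -addSn; apply: le_trans IHm.
  by rewrite ce -{2}mod2 -m2g !mulrA.
Qed.

End L2Bound.

(** * Comparison of energies and uniqueness of the moments *)

Section Moments.
Variable R : realType.

(** For k = 1 and k = 0, up to a factor, the real and imaginary parts of the Stieltjes
    transform of the law of X at the point i b. *)
Definition stieltjes d (T : measurableType d) (P : probability T R) (X : T -> R) (k : nat) (b : R) : R :=
  \int[P]_t (X t ^+ k / (X t ^+ 2 + b ^+ 2)).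

Section OneMeasure.
Context d (T : measurableType d).
Variables (P : probability T R) (X : T -> R).
Hypotheses (bX : bmeas X) (X01 : forall t, 0 <= X t <= 1).

Lemma bmeas_stieltjes k (b : R) : 0 < b ->
  bmeas (fun t => X t ^+ k / (X t ^+ 2 + b ^+ 2)).
Proof.
move=> b0; have cf := @continuous_rational R b 'X^k b0.
have -> : (fun t => X t ^+ k / (X t ^+ 2 + b ^+ 2)) =
   (fun x => ('X^k).[x] / (x ^+ 2 + b ^+ 2)) \o X.
  by apply/funext => t; rewrite /= hornerXn.
exact: bmeas_comp.
Qed.

Lemma moment_stieltjes k (b : R) : 0 < b ->
  \int[P]_t (X t ^+ k) = b ^+ 2 * stieltjes P X k b + stieltjes P X k.+2 b.
Proof.
move=> b0; have h1 := bmeas_stieltjes k b0; have h2 := bmeas_stieltjes k.+2 b0.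
rewrite /stieltjes -meanZ// -meanD//; last exact: bmeasZ.
apply: eq_Rintegral => t _; rewrite (exprD _ 2 k : X t ^+ k.+2 = _); field.
by rewrite lt0r_neq0// ltr_wpDl ?exprn_gt0// sqr_ge0.
Qed.

Lemma stieltjes_itv k (b : R) : 0 < b -> 0 <= stieltjes P X k b <= (b ^+ 2)^-1.
Proof.
move=> b0; have h := bmeas_stieltjes k b0.
have D0 t : 0 < X t ^+ 2 + b ^+ 2 by rewrite ltr_wpDl ?exprn_gt0// sqr_ge0.
apply/andP; split.
  apply: le_mean_cst => // t; have /andP[x0 x1] := X01 t.
  by rewrite divr_ge0 ?exprn_ge0// ltW.
apply: mean_le => // t; have /andP[x0 x1] := X01 t.
rewrite ler_pdivrMr// ler_pdivlMl ?exprn_gt0//.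
rewrite (@le_trans _ _ (b ^+ 2))//; last by rewrite lerDr sqr_ge0.
by rewrite -[leRHS]mulr1 ler_pM2l ?exprn_gt0// exprn_ile1.
Qed.

End OneMeasure.

(** Expansion of the Stieltjes transform at infinity, one coefficient at a time:
    b^2 times the k-th transform tends to the k-th moment, and x^2 = (x^2 + b^2) - b^2
    passes from k to k + 2. *)
Lemma eq_moments d1 d2 (T1 : measurableType d1) (T2 : measurableType d2)
    (P : probability T1 R) (X : T1 -> R) (Q : probability T2 R) (Y : T2 -> R) :
  bmeas X -> bmeas Y -> (forall t, 0 <= X t <= 1) -> (forall t, 0 <= Y t <= 1) ->
  (forall b : R, 0 < b -> stieltjes P X 0 b = stieltjes Q Y 0 b) ->
  (forall b : R, 0 < b -> stieltjes P X 1 b = stieltjes Q Y 1 b) ->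
  forall k, \int[P]_t (X t ^+ k) = \int[Q]_t (Y t ^+ k).
Proof.
move=> bX bY X01 Y01 S0 S1.
have mom k : (forall b : R, 0 < b -> stieltjes P X k b = stieltjes Q Y k b) ->
    \int[P]_t (X t ^+ k) = \int[Q]_t (Y t ^+ k).
  move=> Sk; apply/eqP; rewrite -subr_eq0 -normr_le0 leNgt; apply/negP.
  set D := `|_| => D0.
  pose b : R := 1 + D^-1.
  have b1 : 1 <= b by rewrite lerDl invr_ge0 ltW.
  have b0 : 0 < b by exact: lt_le_trans b1.
  have : D <= (b ^+ 2)^-1.
    rewrite /D (moment_stieltjes P bX k b0) (moment_stieltjes Q bY k b0) Sk//.
    have /andP[h1 h2] := stieltjes_itv P bX X01 k.+2 b0.
    have /andP[h3 h4] := stieltjes_itv Q bY Y01 k.+2 b0.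
    by rewrite opprD addrACA subrr add0r ler_norml; apply/andP; split; lra.
  apply/negP; rewrite -ltNge invf_plt ?posrE ?exprn_gt0//.
  have : b <= b ^+ 2 by rewrite expr2 ler_peMr// ltW.
  by apply: lt_le_trans; rewrite /b ltrDr.
have S k : (forall b : R, 0 < b -> stieltjes P X k b = stieltjes Q Y k b) /\
   (forall b : R, 0 < b -> stieltjes P X k.+1 b = stieltjes Q Y k.+1 b).
  elim: k => [//|k [IH1 IH2]]; split => // b b0.
  have := mom k IH1; rewrite (moment_stieltjes P bX k b0) (moment_stieltjes Q bY k b0).
  by rewrite IH1// => /addrI.
by move=> k; apply: mom; case: (S k).
Qed.

End Moments.

Section EnergyComparison.
Variables (R : realType) (g V : nat -> R).
Hypothesis g08 : forall s, 0 < g s <= 1 / 8.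
Hypothesis Vrec : forall s, 2 * V s = - ln (g s) + V s.+1.
Hypothesis V0 : forall s, 0 <= V s.
Hypothesis Vlim : forall eps : R, 0 < eps -> exists m, (V m + 1) * (1 / 2) ^+ m < eps.
Local Notation unif := (@unif01 R).
Local Notation cp := (cantor_point g 0).
Local Notation TR := (measurableTypeR R).

Context d (T : measurableType d).
Variables (nu : probability T R) (X : T -> R).
Hypotheses (bX : bmeas X) (XK : forall t, Kreal g 0 (X t)).

Let X01 t : 0 <= X t <= 1. Proof. exact: Kreal_itv (XK t). Qed.

Lemma reg_mutual_potential (e : R) : 0 < e ->
  reg_mutual e nu X unif cp = \int[nu]_t reg_potential g e 0 (X t).
Proof.
move=> e0; rewrite /reg_mutual iterated_mean//.
apply: bmeas_reglog => //; apply: bmeasB; first exact: (bmeas_fst _ bX).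
exact: (bmeas_snd _ (bmeas_cantor_point g08 0)).
Qed.

Let bmeas_reg_potential (e : R) : 0 < e -> bmeas (fun t => reg_potential g e 0 (X t)).
Proof.
move=> e0; pose F (z : T * TR) := reglog e (X z.1 - cp z.2).
apply: (@bmeas_mean_section _ _ _ _ _ nu unif F).
apply: bmeas_reglog => //; apply: bmeasB; first exact: (bmeas_fst _ bX).
exact: (bmeas_snd _ (bmeas_cantor_point g08 0)).
Qed.

Lemma reg_mutual_potential_le (e : R) : 0 < e -> e <= 1 -> reg_mutual e nu X unif cp <= V 0.
Proof.
move=> e0 e1; rewrite reg_mutual_potential//; apply: mean_le; first exact: bmeas_reg_potential.
by move=> t; apply: (reg_potential_le g08 Vrec V0).
Qed.

Lemma reg_mutual_potential_ge (eta : R) : 0 < eta -> exists2 e0 : R, 0 < e0 <= 1 &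
  forall e : R, 0 < e -> e <= e0 -> V 0 - eta <= reg_mutual e nu X unif cp.
Proof.
move=> /(reg_potential_ge g08 Vrec Vlim)[e0 e01 H]; exists e0 => // e h1 h2.
rewrite reg_mutual_potential//; apply: le_mean_cst; first exact: bmeas_reg_potential.
by move=> t; apply: H.
Qed.

End EnergyComparison.

Section EnergyMinimum.
Variables (R : realType) (g V : nat -> R).
Hypothesis g08 : forall s, 0 < g s <= 1 / 8.
Hypothesis Vrec : forall s, 2 * V s = - ln (g s) + V s.+1.
Hypothesis V0 : forall s, 0 <= V s.
Hypothesis Vlim : forall eps : R, 0 < eps -> exists m, (V m + 1) * (1 / 2) ^+ m < eps.
Local Notation unif := (@unif01 R).
Local Notation cp := (cantor_point g 0).
Local Notation TR := (measurableTypeR R).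

Context d (T : measurableType d).
Variables (nu : probability T R) (X : T -> R) (EN : R).
Hypotheses (bX : bmeas X) (XK : forall t, Kreal g 0 (X t)).
Hypothesis reg_mutual_le_EN : forall e : R, 0 < e -> e <= 1 -> reg_mutual e nu X nu X <= EN.

Let X01 t : 0 <= X t <= 1. Proof. exact: Kreal_itv (XK t). Qed.
Let bcp : bmeas (cp : TR -> R). Proof. exact: bmeas_cantor_point. Qed.
Let cp01 t : 0 <= cp t <= 1. Proof. exact: cantor_point_itv. Qed.

(** Positive definiteness, where the mutual energy with the random point is V 0 up to an
    error that vanishes with e, and the self energy of the random point is at most V 0.
    The first Cayley coefficients at height e are transforms at the same b for every e. *)
Lemma stieltjes_gap (b : R) : 0 < b ->
  b ^+ 2 * (b ^+ 2 * (stieltjes nu X 0 b - stieltjes unif cp 0 b) ^+ 2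
    + (stieltjes nu X 1 b - stieltjes unif cp 1 b) ^+ 2) <= EN - V 0.
Proof.
move=> b0; rewrite leNgt; apply/negP; set S := _ * _ => h.
have eta0 : 0 < (S - (EN - V 0)) / 4 by rewrite divr_gt0// subr_gt0.
have [e0 /andP[e00 e01] H] := reg_mutual_potential_ge g08 Vrec Vlim nu bX XK eta0.
pose e := Num.min e0 b / 2.
have m0 : 0 < Num.min e0 b by rewrite lt_min e00.
have e_gt0 : 0 < e by rewrite divr_gt0.
have ee0 : e <= e0.
  have : Num.min e0 b <= e0 by rewrite ge_min lexx.
  by rewrite /e; lra.
have eb : e < b.
  have : Num.min e0 b <= b by rewrite ge_min lexx orbT.
  by rewrite /e; lra.
pose c := b - e; have c0 : 0 <= c by rewrite subr_ge0 ltW.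
have cb : c < b by rewrite /c; lra.
have := reg_mutual_ge_gap c0 cb nu unif bX bcp X01 cp01.
have -> : b - c = e by rewrite /c; ring.
have h1 := H e e_gt0 ee0.
have e1 : e <= 1 by exact: le_trans e01.
have h2 := reg_mutual_le_EN e_gt0 e1.
have h3 := reg_mutual_potential_le g08 Vrec V0 unif bcp (cantor_point_Kreal g08 0) e_gt0 e1.
have RE d' (T' : measurableType d') (P : probability T' R) (Y : T' -> R) : bmeas Y ->
   \int[P]_t complex.Re (cayley b c (Y t) ^+ 1) = 1 - b * (b + c) * stieltjes P Y 0 b.
  move=> bY; have bs := bmeas_stieltjes bY 0 b0.
  rewrite /stieltjes -meanZ// -[X in X - _](mean_cst P) -meanB//; last first.
  - exact: bmeasZ.
  - exact: bmeas_cst.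
  apply: eq_Rintegral => t _; rewrite expr1 /cayley/= expr0; field.
  by rewrite lt0r_neq0// ltr_wpDl ?exprn_gt0// sqr_ge0.
have IM d' (T' : measurableType d') (P : probability T' R) (Y : T' -> R) : bmeas Y ->
   \int[P]_t complex.Im (cayley b c (Y t) ^+ 1) = - (b + c) * stieltjes P Y 1 b.
  move=> bY; have bs := bmeas_stieltjes bY 1 b0.
  rewrite /stieltjes -meanZ//.
  apply: eq_Rintegral => t _; rewrite expr1 /cayley/= expr1; field.
  by rewrite lt0r_neq0// ltr_wpDl ?exprn_gt0// sqr_ge0.
rewrite !RE// !IM// => h4.
have : S <= (1 - b * (b + c) * stieltjes nu X 0 b - (1 - b * (b + c) * stieltjes unif cp 0 b)) ^+ 2
   + (- (b + c) * stieltjes nu X 1 b - - (b + c) * stieltjes unif cp 1 b) ^+ 2.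
  have -> : (1 - b * (b + c) * stieltjes nu X 0 b - (1 - b * (b + c) * stieltjes unif cp 0 b)) ^+ 2
   + (- (b + c) * stieltjes nu X 1 b - - (b + c) * stieltjes unif cp 1 b) ^+ 2 =
    (b + c) ^+ 2 * (b ^+ 2 * (stieltjes nu X 0 b - stieltjes unif cp 0 b) ^+ 2
    + (stieltjes nu X 1 b - stieltjes unif cp 1 b) ^+ 2) by ring.
  rewrite /S ler_wpM2r//; first by apply: addr_ge0; [apply: mulr_ge0|]; exact: sqr_ge0.
  by rewrite lerXn2r ?nnegrE//; lra.
rewrite -/S; lra.
Qed.

Lemma energy_ge_V0 : V 0 <= EN.
Proof.
have := stieltjes_gap (@ltr01 R); set S := _ * _ => h.
have : 0 <= S.
  apply: mulr_ge0; first exact: sqr_ge0.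
  by apply: addr_ge0; [apply: mulr_ge0|]; exact: sqr_ge0.
lra.
Qed.

Lemma minimizer_moments k : EN <= V 0 ->
  \int[nu]_t (X t ^+ k) = \int[unif]_t (cp t ^+ k).
Proof.
move=> ENV; have gap (b : R) : 0 < b -> stieltjes nu X 0 b = stieltjes unif cp 0 b /\
    stieltjes nu X 1 b = stieltjes unif cp 1 b.
  move=> b0; have := stieltjes_gap b0; set u := _ - _; set v := stieltjes _ _ 1 _ - _ => h.
  have b2 : 0 < b ^+ 2 by rewrite exprn_gt0.
  have u0 : 0 <= b ^+ 2 * u ^+ 2 by apply: mulr_ge0; exact: sqr_ge0.
  have v0 : 0 <= v ^+ 2 by exact: sqr_ge0.
  have hs : b ^+ 2 * u ^+ 2 + v ^+ 2 == 0.
    by rewrite eq_le (addr_ge0 u0 v0) andbT -(pmulr_rle0 _ b2); lra.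
  move: hs; rewrite paddr_eq0// => /andP[].
  rewrite mulf_eq0 !sqrf_eq0 (gt_eqF b0)/= !subr_eq0 => /eqP -> /eqP ->.
  by [].
by apply: eq_moments => // b /gap[].
Qed.

Lemma minimizer_mean_poly (p : {poly R}) : EN <= V 0 ->
  \int[nu]_t p.[X t] = \int[unif]_t p.[cp t].
Proof.
move=> ENV; have E d' (T' : measurableType d') (P : probability T' R) (Y : T' -> R) : bmeas Y ->
   \int[P]_t p.[Y t] = \sum_(i < size p) p`_i * \int[P]_t (Y t ^+ i).
  move=> bY; under eq_Rintegral do rewrite horner_coef.
  rewrite mean_sum; last by move=> i; apply: bmeasZ; exact: bmeasX.
  by apply: eq_bigr => i _; rewrite meanZ//; exact: bmeasX.
by rewrite !E//; apply: eq_bigr => i _; rewrite minimizer_moments.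
Qed.

End EnergyMinimum.

(** * Borel structure of the complex plane *)

Section ComplexBorel.
Variable R : realType.
Local Notation TR := (measurableTypeR R).
Local Notation C := (borelC R).

Let ReB (z w : R[i]) : complex.Re z - complex.Re w = complex.Re (z - w).
Proof. by case: z w => [a b] [c d]. Qed.

Let ImB (z w : R[i]) :
  complex.Im z - complex.Im w = - complex.Re ('i%C * (z - w)).
Proof. by case: z w => [a b] [c d] /=; ring. Qed.

Lemma continuous_Re : continuous (@complex.Re R : R[i]^o -> R).
Proof.
move=> z; apply/(@cvgrPdist_lt _ _ _ (nbhs (z : R[i]^o)) (nbhs_filter _)) => e e0.
have e0' : 0 < (e%:C)%C by rewrite ltcR.
near=> w; rewrite -ltcR.
have : `|z - w| < (e%:C)%C by near: w; exact: (@nbhsx_ballx _ (R[i]^o) z _ e0').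
apply: le_lt_trans; rewrite ReB.
exact: normc_ge_Re.
Unshelve. all: end_near.
Qed.

Lemma continuous_Im : continuous (@complex.Im R : R[i]^o -> R).
Proof.
move=> z; apply/(@cvgrPdist_lt _ _ _ (nbhs (z : R[i]^o)) (nbhs_filter _)) => e e0.
have e0' : 0 < (e%:C)%C by rewrite ltcR.
near=> w; rewrite -ltcR.
have : `|z - w| < (e%:C)%C by near: w; exact: (@nbhsx_ballx _ (R[i]^o) z _ e0').
apply: le_lt_trans; rewrite ImB.
rewrite normrN (le_trans (normc_ge_Re _))// normrM.
by rewrite (_ : `|'i%C| = 1) ?mul1r// normc_def/= expr0n expr1n add0r sqrtr1.
Unshelve. all: end_near.
Qed.

Lemma continuous_real_complex : continuous ((fun x : R => (x%:C)%C) : R -> R[i]^o).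
Proof.
move=> x; apply/(@cvgrPdist_lt R[i] R[i]^o _ (nbhs (x : R)) (nbhs_filter _)) => e e0.
have e00 : 0 < complex.Re e by move: e0; rewrite ltcE/= => /andP[].
have eE : e = ((complex.Re e)%:C)%C.
  by case: (e) e0 => a b; rewrite ltcE/= => /andP[/eqP -> _].
near=> y; rewrite eE -rmorphB/= normc_def/= expr0n addr0 ltcR sqrtr_sqr.
by near: y; exact: (@nbhsx_ballx _ R x _ e00).
Unshelve. all: end_near.
Qed.

Lemma open_measurableC (U : set R[i]^o) : open U -> measurable (U : set C).
Proof. by move=> oU; exact: sub_sigma_algebra. Qed.

Lemma continuous_measurableC (f : R[i]^o -> R) : continuous f ->
  measurable_fun setT (f : C -> TR).
Proof.
move=> cf; apply: (measurability _ (RGenOpens.measurableE R)).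
move=> _ [_ [a [b ->] <-]]; rewrite setTI; apply: open_measurableC.
by move/continuousP : cf; apply; exact: interval_open.
Qed.

Lemma measurable_Re : measurable_fun setT (@complex.Re R : C -> TR).
Proof. exact: (continuous_measurableC continuous_Re). Qed.

Lemma measurable_Im : measurable_fun setT (@complex.Im R : C -> TR).
Proof. exact: (continuous_measurableC continuous_Im). Qed.

Lemma measurable_real_complex : measurable_fun setT ((fun x : R => (x%:C)%C) : TR -> C).
Proof.
apply: (@measurability _ _ TR C setT _ (@open R[i]^o : set (set C))) => //.
move=> _ [U oU <-]; rewrite setTI; apply: open_measurable.
by move/continuousP : continuous_real_complex; apply.
Qed.

End ComplexBorel.

(** * The Cantor set in real coordinates *)

(** The parameters of the construction start at index 1. *)
Definition shift_seq (R : realType) (gamma : nat -> R) (s : nat) : R := gamma s.+1.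

Section KsetReal.
Variables (R : realType) (gamma : nat -> R).
Hypothesis gamma0 : forall s, 0 < gamma s.+1.
Local Notation g := (shift_seq gamma).

Lemma orbitSr (m s : nat) (x : R) :
  logistic_orbit g m.+1 s x = logistic_orbit g m s x * (1 - logistic_orbit g m s x) / g (s + m)%N.
Proof.
elim: m s x => [|m IH] s x; first by rewrite /= addn0.
by rewrite -[LHS]/(logistic_orbit g m.+1 s.+1 (x * (1 - x) / g s)) IH addSnnS.
Qed.

Lemma rseq_gt0 s : 0 < rseq gamma s.
Proof. by elim: s => [|s IH] /=; rewrite ?ltr01// mulr_gt0// exprn_gt0. Qed.

(** The change of variables P_{2^s} = - r_s v_s. *)
Lemma Ppoly_orbit k (x : R) :
  (Ppoly gamma k).[(x%:C)%C] = ((- (rseq gamma k.+1 * logistic_orbit g k.+1 0 x))%:C)%C.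
Proof.
elim: k => [|k IH].
  rewrite [Ppoly _ _]/= !hornerE -(rmorph1 (real_complex R)).
  rewrite -rmorphB -rmorphM /= expr1n mulr1 /shift_seq; congr (_%:C)%C; field.
  by rewrite lt0r_neq0.
have -> : Ppoly gamma k.+1 =
  Ppoly gamma k * (Ppoly gamma k + ((rseq gamma k.+1)%:C%:P)%C) by [].
have -> : rseq gamma k.+2 = gamma k.+2 * rseq gamma k.+1 ^+ 2 by [].
rewrite hornerM hornerD hornerC IH -rmorphD -rmorphM (orbitSr k.+1) add0n /shift_seq.
move: (logistic_orbit _ _ _ _) (rseq _ _) => v r; congr (_%:C)%C.
by field; rewrite lt0r_neq0.
Qed.

Lemma KsetE : Kset gamma = [set z | complex.Im z = 0 /\ Kreal g 0 (complex.Re z)].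
Proof.
have EsetS k (x : R) : Eset gamma k.+1 (x%:C)%C <-> 0 <= logistic_orbit g k.+1 0 x <= 1.
  rewrite /Eset /segC/= Ppoly_orbit -(rmorph1 (real_complex R)) -rmorphM -rmorphD.
  have -> : 2 / rseq gamma k.+1 * - (rseq gamma k.+1 * logistic_orbit g k.+1 0 x) + 1 =
      1 - 2 * logistic_orbit g k.+1 0 x by field; rewrite lt0r_neq0// rseq_gt0.
  split => [[y + [yE]]|/andP[h1 h2]].
    by rewrite /= in_itv/= yE => /andP[h1 h2]; apply/andP; split; lra.
  exists (1 - 2 * logistic_orbit g k.+1 0 x) => //.
  by rewrite /= in_itv/=; apply/andP; split; lra.
apply/seteqP; split => [z Kz|[x y] /= [-> Kx] [|k] _].
- have [x x01 zE] : Eset gamma 0 z by exact: Kz.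
  rewrite -zE; split => //= -[|m].
    by move: x01; rewrite /= in_itv.
  by apply/EsetS; rewrite zE; exact: Kz.
- exists x => //; have := Kx 0%N.
  by rewrite /= in_itv.
- exact/EsetS/Kx.
Qed.

Lemma continuous_orbit m s : continuous (logistic_orbit g m s).
Proof.
elim: m s => [|m IH] s; first by move=> x; exact: cvg_id.
apply: (@continuous_comp_all _ (fun x => x * (1 - x) / g s) (logistic_orbit g m s.+1)); last exact: IH.
move=> x; apply: cvgM; last exact: cvg_cst.
by apply: cvgM; [exact: cvg_id | apply: cvgB; [exact: cvg_cst | exact: cvg_id]].
Qed.

Lemma closed_Kset : closed (Kset gamma : set R[i]^o).
Proof.
have -> : Kset gamma = (@complex.Im R : R[i]^o -> R) @^-1` [set 0] `&`
   \bigcap_m ((@complex.Re R : R[i]^o -> R) @^-1` (logistic_orbit g m 0 @^-1` `[0, 1]%classic)).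
  rewrite KsetE; apply/seteqP; split => z /= [h1 h2]; split => // m.
    by move=> _; rewrite /= in_itv/= h2.
  by have := h2 m Logic.I; rewrite /= in_itv.
apply: closedI.
  apply: closed_comp; last exact: closed_eq.
  by move=> z _; exact: continuous_Im.
apply: closed_bigI => m _; apply: closed_comp; first by move=> z _; exact: continuous_Re.
apply: closed_comp; first by move=> z _; exact: continuous_orbit.
exact: itv_closed.
Qed.

Lemma measurable_Kset : measurable (Kset gamma : set (borelC R)).
Proof.
rewrite -[X in measurable X]setCK; apply: measurableC; apply: open_measurableC.
by rewrite openC; exact: closed_Kset.
Qed.

(** The real coordinate of a point of the Cantor set, collapsed to [0] elsewhere
    so that it takes values in the Cantor set everywhere. *)
Definition coordK (z : borelC R) : R := complex.Re z * \1_(Kset gamma) z.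

Lemma coordK_in z : Kset gamma z -> coordK z = complex.Re z.
Proof. by move=> Kz; rewrite /coordK indicE mem_set// mulr1. Qed.

Lemma coordK_Kreal z : Kreal g 0 (coordK z).
Proof.
rewrite /coordK indicE; case: (boolP (z \in Kset gamma)) => [|_].
  by rewrite inE KsetE mulr1 => -[].
rewrite mulr0 => m; elim: m 0%N => [|m IH] s /=; first by rewrite lexx ler01.
by rewrite mul0r mul0r.
Qed.

Lemma coordK_itv z : 0 <= coordK z <= 1.
Proof. exact: Kreal_itv (coordK_Kreal z). Qed.

Lemma bmeas_coordK : bmeas coordK.
Proof.
split.
  apply: measurable_funM; first exact: measurable_Re.
  by apply: measurable_indic; exact: measurable_Kset.
by exists 1 => z; have /andP[h1 h2] := coordK_itv z; rewrite ger0_norm.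
Qed.

Lemma Kset_coordK z : Kset gamma z -> z = ((coordK z)%:C)%C.
Proof.
move=> Kz; rewrite coordK_in//; move: Kz; rewrite KsetE => -[].
by case: z => a b /= ->.
Qed.

Lemma Kset_real (x : R) : Kreal g 0 x -> Kset gamma (x%:C)%C.
Proof. by move=> Kx; rewrite KsetE. Qed.

End KsetReal.

(** * The logarithmic energy of measures on the Cantor set *)

Section ExtendedLogKernel.
Variable R : realType.
Local Notation TR := (measurableTypeR R).

Definition log_dist (d : R) : \bar R := (- lne (`|d|)%:E)%E.

Lemma log_dist0 : log_dist 0 = +oo%E.
Proof. by rewrite /log_dist normr0 /= lexx. Qed.

Lemma log_distE d : d != 0 -> log_dist d = (- ln `|d|)%:E.
Proof. by move=> d0; rewrite /log_dist lne_EFin// normr_gt0. Qed.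

Lemma measurable_log_dist : measurable_fun setT (log_dist : TR -> \bar R).
Proof.
apply: measurableT_comp => //.
have -> : (fun d : TR => lne (`|d|)%:E) =
    (fun d : TR => if d == 0 then -oo%E else (ln `|d|)%:E).
  by apply/funext => d /=; rewrite normr_le0.
apply: measurable_fun_ifT.
- by apply: measurable_fun_eqr; [exact: measurable_id | exact: measurable_cst].
- exact: measurable_cst.
- apply/measurable_EFinP; apply: measurableT_comp; first exact: measurable_ln.
  exact: (continuous_measurable_fun (@norm_continuous R R)).
Qed.

Lemma measurable_log_dist_comp d (T : measurableType d) (f : T -> TR) :
  measurable_fun setT f -> measurable_fun setT (fun t => log_dist (f t)).
Proof. by move=> mf; apply: measurableT_comp => //; exact: measurable_log_dist. Qed.

Lemma log_dist_ge0 d : -1 <= d <= 1 -> (0 <= log_dist d)%E.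
Proof.
move=> d1; have [->|d0] := eqVneq d 0; first by rewrite log_dist0.
by rewrite log_distE// lee_fin oppr_ge0 ln_le0// ler_norml.
Qed.

Lemma reglog_le_log_dist (e d : R) : 0 < e -> ((reglog e d)%:E <= log_dist d)%E.
Proof.
move=> e0; have [->|d0] := eqVneq d 0; first by rewrite log_dist0 leey.
rewrite log_distE// lee_fin /reglog.
have -> : - ln `|d| = - (1 / 2) * ln (d ^+ 2).
  by rewrite -real_normK ?num_real// lnXn ?normr_gt0// -[ln _ *+ 2]mulr_natl; lra.
have d2 : 0 < d ^+ 2 by rewrite exprn_even_gt0.
rewrite ler_nM2l; last by lra.
by rewrite ler_ln ?posrE ?ltr_wpDr ?sqr_ge0// lerDl sqr_ge0.
Qed.

Lemma cvg_reglog (d : R) : ((reglog n.+1%:R^-1 d)%:E @[n --> \oo] --> log_dist d)%E.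
Proof.
have [->|d0] := eqVneq d 0.
  rewrite log_dist0; apply/cvgeryP.
  have -> : (fun n => reglog n.+1%:R^-1 0) = (fun n => ln (n.+1%:R : R)).
    apply/funext => n; rewrite /reglog expr0n add0r lnXn ?invr_gt0// lnV ?posrE//.
    by rewrite -[(- ln _) *+ 2]mulr_natl; lra.
  apply/cvgryPge => A; near=> n.
  rewrite -[A]expRK ler_ln ?posrE ?expR_gt0//.
  rewrite (@le_trans _ _ n%:R)//; last by rewrite ler_nat.
  by near: n; exact: nbhs_infty_ger.
rewrite log_distE//; apply: cvg_EFin; first by apply: nearW.
have -> : - ln `|d| = - (1 / 2) * ln (d ^+ 2 + 0 ^+ 2).
  rewrite expr0n addr0 -real_normK ?num_real// lnXn ?normr_gt0//.
  by rewrite -[ln _ *+ 2]mulr_natl; lra.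
have d2 : 0 < d ^+ 2 by rewrite exprn_even_gt0.
rewrite /comp/= /reglog; apply: cvgM; first exact: cvg_cst.
apply: (@cvg_comp _ _ _ (fun n => d ^+ 2 + n.+1%:R^-1 ^+ 2) (@ln R) _ (nbhs (d ^+ 2 + 0 ^+ 2))).
  apply: cvgD; first exact: cvg_cst.
  rewrite expr2; under eq_fun do rewrite expr2.
  by apply: cvgM; exact: cvg_harmonic.
by apply: continuous_ln; rewrite expr0n addr0.
Unshelve. all: end_near.
Qed.

End ExtendedLogKernel.

Section IteratedMeasurability.
Context d1 d2 (T1 : measurableType d1) (T2 : measurableType d2) (R : realType).
Variable (Q : probability T2 R).

Lemma measurable_iterated (f : T1 * T2 -> \bar R) : measurable_fun setT f ->
  measurable_fun setT (fun x => \int[Q]_y f (x, y))%E.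
Proof.
move=> mf; have -> : (fun x => \int[Q]_y f (x, y))%E =
   ((fun x => \int[Q]_y (f^\+ (x, y))) \- (fun x => \int[Q]_y (f^\- (x, y))))%E.
  apply/funext => x; rewrite [LHS]integralE.
  under eq_integral do rewrite funepos_comp/=.
  by under [X in (_ - X = _)%E]eq_integral do rewrite funeneg_comp/=.
apply: emeasurable_funB.
- apply: (measurable_fun_fubini_tonelli_F (f^\+)%E) => //; exact: measurable_funepos.
- apply: (measurable_fun_fubini_tonelli_F (f^\-)%E) => //; exact: measurable_funeneg.
Qed.

End IteratedMeasurability.

Section LogEnergy.
Variables (R : realType) (gamma V : nat -> R).
Local Notation g := (shift_seq gamma).
Hypothesis g08 : forall s, 0 < g s <= 1 / 8.
Hypothesis Vrec : forall s, 2 * V s = - ln (g s) + V s.+1.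
Hypothesis V0 : forall s, 0 <= V s.
Hypothesis Vlim : forall eps : R, 0 < eps -> exists m, (V m + 1) * (1 / 2) ^+ m < eps.
Local Notation TR := (measurableTypeR R).
Local Notation C := (borelC R).
Local Notation K := (Kset gamma).
Local Notation X := (coordK gamma).
Local Notation unif := (@unif01 R).
Local Notation cp := (cantor_point g 0).

Let gamma0 s : 0 < gamma s.+1. Proof. by have /andP[] := g08 s. Qed.

Let bX : bmeas X. Proof. exact: bmeas_coordK. Qed.
Let mX : measurable_fun setT (X : C -> TR). Proof. by case: bX. Qed.
Let mK : measurable (K : set C). Proof. exact: measurable_Kset. Qed.

Lemma log_kernelE (z w : C) : log_kernel z w =
  log_dist (Num.sqrt ((complex.Re z - complex.Re w) ^+ 2 + (complex.Im z - complex.Im w) ^+ 2)).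
Proof.
rewrite /log_dist ger0_norm ?sqrtr_ge0// /log_kernel.
by case: z w => [a b] [c d].
Qed.

Lemma log_kernel_coordK (z w : C) : K z -> K w -> log_kernel z w = log_dist (X z - X w).
Proof.
move=> Kz Kw; rewrite log_kernelE !coordK_in//.
move: Kz Kw; rewrite KsetE// => -[-> _] [-> _].
by rewrite subrr expr0n addr0 sqrtr_sqr /log_dist normr_id.
Qed.

Let measurable_log_kernel : measurable_fun setT (fun p : C * C => log_kernel p.1 p.2).
Proof.
have -> : (fun p : C * C => log_kernel p.1 p.2) = (fun p : C * C => log_dist
   (Num.sqrt ((complex.Re p.1 - complex.Re p.2) ^+ 2 + (complex.Im p.1 - complex.Im p.2) ^+ 2))).
  by apply/funext => p; rewrite log_kernelE.
apply: measurable_log_dist_comp.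
apply: (@measurableT_comp _ _ _ _ TR TR (@Num.sqrt R : TR -> TR)).
  exact: (continuous_measurable_fun (@sqrt_continuous R)).
have m1 : measurable_fun setT (fun p : C * C => complex.Re p.1 : TR).
  by apply: (measurableT_comp (@measurable_Re R)).
have m2 : measurable_fun setT (fun p : C * C => complex.Re p.2 : TR).
  by apply: (measurableT_comp (@measurable_Re R)).
have m3 : measurable_fun setT (fun p : C * C => complex.Im p.1 : TR).
  by apply: (measurableT_comp (@measurable_Im R)).
have m4 : measurable_fun setT (fun p : C * C => complex.Im p.2 : TR).
  by apply: (measurableT_comp (@measurable_Im R)).
by apply: measurable_funD; apply: measurable_funX; exact: measurable_funB.
Qed.

Let measurable_coordK_kernel : measurable_fun setT (fun p : C * C => log_dist (X p.1 - X p.2)).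
Proof.
apply: measurable_log_dist_comp.
by apply: measurable_funB; apply: (measurableT_comp mX).
Qed.

Let coordK_kernel_ge0 z w : (0 <= log_dist (X z - X w))%E.
Proof.
apply: log_dist_ge0; have /andP[? ?] := coordK_itv gamma0 z.
by have /andP[? ?] := coordK_itv gamma0 w; apply/andP; split; lra.
Qed.

Let ae_K (nu : probability C R) (P : C -> Prop) : prob_on K nu ->
  (forall z : C, K z -> P z) -> {ae nu, forall z, P z}.
Proof.
move=> nuK KP; exists (~` K); split; [exact: measurableC | exact: nuK |].
by move=> z /= nP Kz; apply: nP; exact: KP.
Qed.

(** Off a null set both points lie in the Cantor set, where the kernel depends on the
    real coordinates and is nonnegative, so that Tonelli's theorem applies from here on. *)
Lemma log_energyE (nu : probability C R) : prob_on K nu ->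
  log_energy nu = (\int[nu]_z \int[nu]_w log_dist (X z - X w))%E.
Proof.
move=> nuK; rewrite /log_energy; apply: ae_eq_integral => //.
- exact: (measurable_iterated nu measurable_log_kernel).
- exact: (measurable_iterated nu measurable_coordK_kernel).
apply: ae_K => // z Kz _; apply: ae_eq_integral => //.
- exact: (measurableT_comp measurable_log_kernel (pair1_measurable (z : C))).
- exact: (measurableT_comp measurable_coordK_kernel (pair1_measurable (z : C))).
by apply: ae_K => // w Kw _; exact: log_kernel_coordK.
Qed.

Lemma reg_mutual_le_log_energy (nu : probability C R) (e : R) : prob_on K nu -> 0 < e ->
  ((reg_mutual e nu X nu X)%:E <= log_energy nu)%E.
Proof.
move=> nuK e0; rewrite log_energyE//.
rewrite -(fubini_tonelli1 (fun p : C * C => log_dist (X p.1 - X p.2)))//.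
have bk : bmeas (fun p : C * C => reglog e (X p.1 - X p.2)).
  by apply: bmeas_reglog => //; apply: bmeasB; [exact: (bmeas_fst _ bX) | exact: (bmeas_snd _ bX)].
have bm : bmeas (fun p : C * C => Num.max (reglog e (X p.1 - X p.2)) 0).
  case: bk => mk [M kM]; split; first by apply: measurable_maxr => //; exact: measurable_cst.
  exists M => p; have M0 := le_trans (normr_ge0 _) (kM p).
  by rewrite ger0_norm ?le_max ?lexx ?orbT// ge_max M0 (le_trans (ler_norm _)).
apply: (@le_trans _ _ (\int[prodP nu nu]_p Num.max (reglog e (X p.1 - X p.2)) 0)%:E).
  by rewrite lee_fin; apply: le_mean => // p; rewrite le_max lexx.
rewrite -mean_EFin//; apply: ge0_le_integral => //.
- by move=> p _; rewrite lee_fin le_max lexx orbT.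
- by apply/measurable_EFinP; case: bm.
- move=> p _; rewrite EFin_max ge_max coordK_kernel_ge0 andbT.
  exact: reglog_le_log_dist.
Qed.

Lemma V0_le_log_energy (nu : probability C R) : prob_on K nu -> ((V 0)%:E <= log_energy nu)%E.
Proof.
move=> nuK; have H e : 0 < e -> ((reg_mutual e nu X nu X)%:E <= log_energy nu)%E.
  by move=> e0; exact: reg_mutual_le_log_energy.
case: (log_energy nu) H => [r| |] H.
- rewrite lee_fin; apply: (energy_ge_V0 g08 Vrec V0 Vlim bX (nu := nu)).
    exact: coordK_Kreal.
  by move=> e e0 _; have := H e e0; rewrite lee_fin.
- by rewrite leey.
- by have := H 1 ltr01; rewrite leeNy_eq.
Qed.

End LogEnergy.

(** * The equilibrium measure and the capacity *)

Section CantorMeasure.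
Variables (R : realType) (gamma V : nat -> R).
Local Notation g := (shift_seq gamma).
Hypothesis g08 : forall s, 0 < g s <= 1 / 8.
Hypothesis Vrec : forall s, 2 * V s = - ln (g s) + V s.+1.
Hypothesis V0 : forall s, 0 <= V s.
Hypothesis Vlim : forall eps : R, 0 < eps -> exists m, (V m + 1) * (1 / 2) ^+ m < eps.
Local Notation TR := (measurableTypeR R).
Local Notation C := (borelC R).
Local Notation K := (Kset gamma).
Local Notation X := (coordK gamma).
Local Notation unif := (@unif01 R).
Local Notation cp := (cantor_point g 0).

Let gamma0 s : 0 < gamma s.+1. Proof. by have /andP[] := g08 s. Qed.

(** Monotone convergence of the smoothed kernels, shifted by 1 to be nonnegative. *)
Lemma potential_le (x : R) : Kreal g 0 x ->
  (\int[unif]_t log_dist (x - cp t) <= (V 0)%:E)%E.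
Proof.
move=> Kx; have /andP[x0 x1] := Kreal_itv Kx.
have cp01 t : -1 <= x - cp t <= 1.
  by have /andP[? ?] := cantor_point_itv g08 0 t; apply/andP; split; lra.
have bk n : bmeas (fun t : TR => reglog n.+1%:R^-1 (x - cp t)).
  apply: bmeas_reglog; first by rewrite invr_gt0.
  by apply: bmeasB; [exact: bmeas_cst | exact: bmeas_cantor_point].
have n01 (n : nat) : 0 < (n.+1%:R^-1 : R) <= 1.
  by rewrite invr_gt0 ltr0n/= invf_le1// ler1n.
pose f n (t : TR) : \bar R := (reglog n.+1%:R^-1 (x - cp t) + 1)%:E.
have mf n : measurable_fun setT (f n).
  by apply/measurable_EFinP; case: (bmeasD (bk n) (bmeas_cst _ 1)).
have f0 n t : [set: TR] t -> (0 <= f n t)%E.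
  move=> _; rewrite lee_fin; have /andP[e0 e1] := n01 n.
  by have := reglog_ge e0 e1 (cp01 t); lra.
have fnd t : [set: TR] t -> nondecreasing_seq (f ^~ t).
  move=> _ m n mn; rewrite lee_fin lerD2r /reglog ler_nM2l; last by lra.
  have p (k : nat) : 0 < (x - cp t) ^+ 2 + k.+1%:R^-1 ^+ 2.
    by rewrite ltr_wpDl ?sqr_ge0// exprn_gt0// invr_gt0.
  by rewrite ler_ln ?posrE// lerD2l lerXn2r ?nnegrE ?invr_ge0// lef_pV2 ?posrE// ler_nat.
have fl t : limn (f ^~ t) = (log_dist (x - cp t) + 1)%E.
  apply/cvg_lim => //; rewrite /f; under eq_fun do rewrite EFinD.
  by apply: cvgeD; [rewrite fin_num_adde_defl | exact: cvg_reglog | exact: cvg_cst].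
have h := cvg_monotone_convergence (mu := unif) measurableT mf f0 fnd.
have intf n : (\int[unif]_t f n t <= (V 0 + 1)%:E)%E.
  rewrite mean_EFin; last by apply: bmeasD; [exact: bk | exact: bmeas_cst].
  rewrite lee_fin meanD//; last exact: bmeas_cst.
  rewrite mean_cst lerD2r; have /andP[e0 e1] := n01 n.
  exact: (reg_potential_le g08 Vrec V0).
have : (\int[unif]_t (log_dist (x - cp t) + 1) <= (V 0 + 1)%:E)%E.
  under eq_integral do rewrite -fl.
  rewrite -(cvg_lim _ h)//; apply: lime_le; first by apply/cvg_ex; eexists; exact: h.
  exact: nearW.
rewrite ge0_integralD//.
- rewrite [X in (_ + X)%E](_ : _ = 1%:E); last first.
    by rewrite integral_cst// mul1e; exact: probability_setT.
  by rewrite EFinD leeD2rE.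
- by move=> t _; apply: log_dist_ge0.
- apply: measurable_log_dist_comp; apply: measurable_funB; first exact: measurable_cst.
  by case: (bmeas_cantor_point g08 0).
Qed.

(** The law of the random point, moved to the complex plane. *)
Lemma cantor_measure : exists2 mu : probability C R,
  prob_on K mu & (log_energy mu <= (V 0)%:E)%E.
Proof.
pose f (t : TR) : C := ((cp t)%:C)%C.
have mcp : measurable_fun setT (cp : TR -> TR) by case: (bmeas_cantor_point g08 0).
have mf : measurable_fun setT f := measurableT_comp (@measurable_real_complex R) mcp.
pose mix := isMeasurableFun.Build _ _ TR C f mf.
pose phi : {mfun TR >-> C} := HB.pack f mix.
pose mu : probability C R := distribution unif phi.
have fK t : K (f t) by apply: Kset_real => //; exact: cantor_point_Kreal.
have muK : prob_on K mu.
  rewrite /prob_on/= /mu /distribution /pushforward.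
  rewrite (_ : _ @^-1` _ = set0) ?measure0//.
  by apply/seteqP; split => t //= nK; apply: nK; exact: fK.
exists mu => //; rewrite (log_energyE g08)//.
have mker : measurable_fun setT (fun p : C * C => log_dist (X p.1 - X p.2)).
  apply: measurable_log_dist_comp; have [mX _] := bmeas_coordK gamma0.
  by apply: measurable_funB; apply: (measurableT_comp mX).
have ker0 z w : (0 <= log_dist (X z - X w))%E.
  apply: log_dist_ge0; have /andP[? ?] := coordK_itv gamma0 z.
  by have /andP[? ?] := coordK_itv gamma0 w; apply/andP; split; lra.
have inner z : (\int[mu]_w log_dist (X z - X w) <= (V 0)%:E)%E.
  rewrite /mu ge0_integral_distribution//; last first.
    exact: (measurableT_comp mker (pair1_measurable (z : C))).
  apply: le_trans (potential_le (coordK_Kreal gamma0 z)).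
  rewrite le_eqVlt; apply/orP; left; apply/eqP; apply: eq_integral => t _ /=.
  by rewrite [X in _ - X](coordK_in (fK t)).
apply: (@le_trans _ _ (\int[mu]_z (cst (V 0)%:E z))%E).
  apply: ge0_le_integral => //.
  - by move=> z _; apply: integral_ge0.
  - exact: (measurable_iterated mu mker).
by rewrite integral_cst// [X in (_ * X <= _)%E]probability_setT mule1.
Qed.

Lemma is_equilibrium_measure : is_equilibrium K (equilibrium_measure K).
Proof.
apply: getPex; have [mu muK muV] := cantor_measure.
exists mu; split => // nu nuK; apply: le_trans muV _.
exact: (V0_le_log_energy g08 Vrec V0 Vlim).
Qed.

Lemma log_energy_equilibrium : log_energy (equilibrium_measure K) = (V 0)%:E.
Proof.
have [eqK eqmin] := is_equilibrium_measure.
apply/eqP; rewrite eq_le (V0_le_log_energy g08 Vrec V0 Vlim)// andbT.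
have [mu muK muV] := cantor_measure; exact: le_trans (eqmin _ muK) muV.
Qed.

(** Stated for a set S between a carrier of the equilibrium measure and K, to cover both
    K and the support. *)
Lemma Cap_prob_on (S : set R[i]) : (forall mu : probability C R, prob_on S mu -> prob_on K mu) ->
  prob_on S (equilibrium_measure K) -> Cap S = expR (- V 0).
Proof.
move=> SK eS; rewrite /Cap (_ : ereal_inf _ = (V 0)%:E)//.
apply/eqP; rewrite eq_le; apply/andP; split.
  apply: ereal_inf_lbound; exists (equilibrium_measure K) => //.
  exact: log_energy_equilibrium.
apply: le_ereal_inf_tmp => _ [mu /SK muK <-].
exact: (V0_le_log_energy g08 Vrec V0 Vlim).
Qed.

End CantorMeasure.

(** * The support and the Widom factors *)

Lemma open_nbhs_subset (T : topologicalType) (A : set T) :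
  (forall z, A z -> nbhs z A) -> open A.
Proof. by move=> nA; rewrite openE. Qed.

Section Support.
Variables (R : realType) (mu : probability (borelC R) R).
Local Notation C := (borelC R).

Lemma open_setC_supp : open (~` supp mu : set R[i]^o).
Proof.
apply: open_nbhs_subset => z /= /existsNP[U] /not_implyP[oU] /not_implyP[Uz U0].
have : nbhs (z : R[i]^o) U by exact: open_nbhs_nbhs.
apply: filterS => w Uw sw; apply: U0; exact: sw.
Qed.

Lemma measurable_supp : measurable (~` supp mu : set C).
Proof. by apply: open_measurableC; exact: open_setC_supp. Qed.

Lemma supp_subset (S : set R[i]^o) : closed S -> prob_on S mu -> supp mu `<=` S.
Proof.
move=> cS muS z sz; apply: contrapT => nSz.
have := sz (~` S) (closed_openC cS) nSz.
by rewrite [X in (_ < X)%E]muS ltxx.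
Qed.

Definition strip (p q : R) : set C := [set z | p < complex.Re z < q].

Lemma measurable_strip p q : measurable (strip p q).
Proof.
have -> : strip p q = (@complex.Re R) @^-1` `]p, q[%classic.
  by apply/seteqP; split => z; rewrite /strip/= in_itv.
by rewrite -[X in measurable X]setTI; apply: measurable_Re.
Qed.

(** A null open set around a point of S contains, up to the null complement of S, a strip
    over a rational interval; there are countably many such strips. *)
Lemma prob_on_supp (S : set R[i]^o) : measurable (S : set C) ->
  (forall z, S z -> complex.Im z = 0) -> prob_on S mu -> prob_on (supp mu) mu.
Proof.
move=> mS Sreal muS.
pose F (k : nat) : set C := if @unpickle (rat * rat)%type k is Some pq
  then (if mu (strip (ratr pq.1) (ratr pq.2)) == 0%E then strip (ratr pq.1) (ratr pq.2) else set0)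
  else set0.
have F0 k : mu.-negligible (F k).
  rewrite /F; case: unpickle => [pq|]; last exact: negligible_set0.
  case: eqP => [h|_]; last exact: negligible_set0.
  by exists (strip (ratr pq.1) (ratr pq.2)); split => //; exact: measurable_strip.
have S0 : mu.-negligible (~` S) by exists (~` S); split => //; exact: measurableC.
have N := negligibleU S0 (negligible_bigcup F0).
suff : mu.-negligible (~` supp mu).
  by move/(negligibleP mu measurable_supp).
apply: negligibleS N => z nz.
have [Sz|] := pselect (S z); [right|by left].
move: nz => /= /existsNP[U] /not_implyP[oU] /not_implyP[Uz U0].
have mU : mu U = 0%E.
  by apply/eqP; rewrite eq_le measure_ge0 andbT leNgt; apply/negP.
have : nbhs (z : R[i]^o) U by exact: open_nbhs_nbhs.
move=> /nbhs_ballP[e /= e0 eU].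
have e00 : 0 < complex.Re e by move: e0; rewrite ltcE/= => /andP[].
have eE : e = ((complex.Re e)%:C)%C.
  by case: (e) e0 => a b; rewrite ltcE/= => /andP[/eqP -> _].
have [p] : exists p, ratr p \in `](complex.Re z - complex.Re e), (complex.Re z)[.
  by apply: rat_in_itvoo; rewrite ltrBlDr ltrDl.
rewrite in_itv/= => /andP[p1 p2].
have [q] : exists q, ratr q \in `](complex.Re z), (complex.Re z + complex.Re e)[.
  by apply: rat_in_itvoo; rewrite ltrDl.
rewrite in_itv/= => /andP[q1 q2].
have sub : strip (ratr p) (ratr q) `<=` U `|` ~` S.
  move=> w /andP[w1 w2]; have [Sw|] := pselect (S w); [left|by right].
  apply: eU; rewrite /ball/= eE normc_def ltcR.
  have -> : complex.Im (z - w) = 0.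
    by have := Sreal _ Sz; have := Sreal _ Sw; case: (z) (w) => [a b] [c d] /= -> ->; rewrite subrr.
  rewrite expr0n addr0 sqrtr_sqr ltr_norml.
  have -> : complex.Re (z - w) = complex.Re z - complex.Re w by case: (z) (w) => [a b] [c d].
  by apply/andP; split; lra.
have s0 : mu (strip (ratr p) (ratr q)) = 0%E.
  apply/eqP; rewrite eq_le measure_ge0 andbT.
  rewrite -[leRHS](_ : mu (U `|` ~` S) = 0%E).
    apply: le_measure => //; rewrite inE; first exact: measurable_strip.
    by apply: measurableU; [exact: open_measurableC | exact: measurableC].
  apply/eqP; rewrite eq_le measure_ge0 andbT.
  have muS' : mu (~` S) = 0%E by exact: muS.
  rewrite -[leRHS](_ : (mu U + mu (~` S) = 0)%E); last by rewrite mU add0e.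
  by apply: measureU2; [exact: open_measurableC | exact: measurableC].
have [k kE] : exists k, @unpickle (rat * rat)%type k = Some (p, q).
  by exists (pickle (p, q)); rewrite pickleK.
exists k => //; rewrite /F kE/= s0 eqxx.
by apply/andP; split.
Qed.

End Support.

Section ComplexHorner.
Variable R : realType.
Local Notation TR := (measurableTypeR R).
Local Notation C := (borelC R).

Definition Re_poly n (p : {poly R[i]}) : {poly R} := \poly_(i < n) complex.Re p`_i.
Definition Im_poly n (p : {poly R[i]}) : {poly R} := \poly_(i < n) complex.Im p`_i.

Let Re_sum n (F : 'I_n -> R[i]) : complex.Re (\sum_(i < n) F i) = \sum_(i < n) complex.Re (F i).
Proof.
by apply: (big_morph (@complex.Re R)) => // -[a b] [c d].
Qed.

Let Im_sum n (F : 'I_n -> R[i]) : complex.Im (\sum_(i < n) F i) = \sum_(i < n) complex.Im (F i).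
Proof.
by apply: (big_morph (@complex.Im R)) => // -[a b] [c d].
Qed.

Lemma horner_real (p : {poly R[i]}) (x : R) :
  p.[(x%:C)%C] = ((Re_poly (size p) p).[x] +i* (Im_poly (size p) p).[x])%C.
Proof.
apply/eqP; rewrite eq_complex/= horner_coef Re_sum Im_sum !horner_poly.
apply/andP; split; apply/eqP; apply: eq_bigr => i _.
- by rewrite -rmorphXn; case: (p`_i) => a b /=; rewrite mulr0 subr0.
- by rewrite -rmorphXn; case: (p`_i) => a b /=; rewrite mulr0 add0r.
Qed.

Lemma measurable_horner (p : {poly R[i]}) :
  measurable_fun setT (fun z : C => complex.Re p.[z] : TR) /\
  measurable_fun setT (fun z : C => complex.Im p.[z] : TR).
Proof.
elim/poly_ind: p => [|p c [IH1 IH2]].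
  by split; under eq_fun do rewrite horner0; exact: measurable_cst.
have mR := @measurable_Re R; have mI := @measurable_Im R.
split.
- have -> : (fun z : C => complex.Re (p * 'X + c%:P).[z]) =
     (fun z : C => complex.Re p.[z] * complex.Re z - complex.Im p.[z] * complex.Im z + complex.Re c).
    apply/funext => z; rewrite hornerD hornerM hornerX hornerC -Re_mulc.
    by case: (_ * _) (c) => [? ?] [? ?].
  apply: measurable_funD; last exact: measurable_cst.
  by apply: measurable_funB; exact: measurable_funM.
- have -> : (fun z : C => complex.Im (p * 'X + c%:P).[z]) =
     (fun z : C => complex.Re p.[z] * complex.Im z + complex.Im p.[z] * complex.Re z + complex.Im c).
    apply/funext => z; rewrite hornerD hornerM hornerX hornerC -Im_mulc.
    by case: (_ * _) (c) => [? ?] [? ?].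
  apply: measurable_funD; last exact: measurable_cst.
  by apply: measurable_funD; exact: measurable_funM.
Qed.

End ComplexHorner.

Section WidomLowerBound.
Variables (R : realType) (gamma V : nat -> R).
Local Notation g := (shift_seq gamma).
Hypothesis g08 : forall s, 0 < g s <= 1 / 8.
Hypothesis Vrec : forall s, 2 * V s = - ln (g s) + V s.+1.
Hypothesis V8 : forall s, ln 8 <= V s.
Hypothesis Vlim : forall eps : R, 0 < eps -> exists m, (V m + 1) * (1 / 2) ^+ m < eps.
Local Notation TR := (measurableTypeR R).
Local Notation C := (borelC R).
Local Notation K := (Kset gamma).
Local Notation X := (coordK gamma).
Local Notation unif := (@unif01 R).
Local Notation cp := (cantor_point g 0).
Local Notation eqm := (equilibrium_measure K).
Local Notation normc := ComplexField.Normc.normc.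

Let gamma0 s : 0 < gamma s.+1. Proof. by have /andP[] := g08 s. Qed.
Let V0 s : 0 <= V s.
Proof. by apply: le_trans (V8 s); apply: ln_ge0; lra. Qed.
Let bX : bmeas X. Proof. exact: bmeas_coordK. Qed.
Let eqmK : prob_on K eqm.
Proof. by have [] := is_equilibrium_measure g08 Vrec V0 Vlim. Qed.

Lemma Cap_Kset : Cap K = expR (- V 0).
Proof. exact: (Cap_prob_on g08 Vrec V0 Vlim). Qed.

Lemma Cap_supp : Cap (supp eqm) = expR (- V 0).
Proof.
have sub := supp_subset (closed_Kset gamma0) eqmK.
apply: (Cap_prob_on g08 Vrec V0 Vlim) => [mu muS|].
  apply/eqP; rewrite eq_le measure_ge0 andbT -[leRHS]muS.
  apply: le_measure; rewrite ?inE.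
  - by apply: measurableC; exact: measurable_Kset.
  - exact: measurable_supp.
  - exact: subsetC.
apply: prob_on_supp eqmK; first exact: measurable_Kset.
by move=> z; rewrite KsetE// => -[].
Qed.

(** On the real line |p|^2 = A^2 + B^2 with A, B the real and imaginary parts, and A is
    monic; the moments of the equilibrium measure are those of the random point. *)
Lemma L2norm_ge n (p : {poly R[i]}) : (0 < n)%N -> monic_deg n p ->
  expR (- V 0) ^+ n * (expR (V (trunc_log 2 n)) / 8) <= fine (L2norm eqm p).
Proof.
move=> n0 [/monicP pm sp].
pose A := Re_poly (size p) p; pose B := Im_poly (size p) p.
have bA : bmeas (fun z => A.[X z] ^+ 2) by apply: bmeasX; exact: bmeas_horner.
have bB : bmeas (fun z => B.[X z] ^+ 2) by apply: bmeasX; exact: bmeas_horner.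
have bAB := bmeasD bA bB.
have pE z : K z -> normc p.[z] ^+ 2 = A.[X z] ^+ 2 + B.[X z] ^+ 2.
  move=> Kz; rewrite {1}(Kset_coordK gamma0 Kz) horner_real /normc.
  by rewrite sqr_sqrtr// addr_ge0// sqr_ge0.
have nE z : normc p.[z] = Num.sqrt (complex.Re p.[z] ^+ 2 + complex.Im p.[z] ^+ 2).
  by case: (p.[z]).
pose I := \int[eqm]_z (A.[X z] ^+ 2 + B.[X z] ^+ 2).
have L2E : L2norm eqm p = (Num.sqrt I)%:E.
  rewrite /L2norm unlock.
  have -> : (\int[eqm]_z (`|(normc p.[z])%:E| `^ 2))%E = I%:E.
    rewrite -mean_EFin//; apply: ae_eq_integral => //.
    - have -> : (fun z => `|(normc p.[z])%:E| `^ 2)%E =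
          (fun z => (complex.Re p.[z] ^+ 2 + complex.Im p.[z] ^+ 2)%:E).
        apply/funext => z; rewrite abse_EFin poweR_EFin powR_mulrn// nE ger0_norm ?sqrtr_ge0//.
        by rewrite sqr_sqrtr// addr_ge0// sqr_ge0.
      have [mRe mIm] := measurable_horner p.
      by apply/measurable_EFinP; apply: measurable_funD; exact: measurable_funX.
    - by apply/measurable_EFinP; case: bAB.
    exists (~` K); split; [by apply: measurableC; exact: measurable_Kset|exact: eqmK|].
    move=> z /= nz Kz; apply: nz => _.
    by rewrite powR_mulrn// ger0_norm ?pE// nE sqrtr_ge0.
  rewrite poweR_EFin powR12_sqrt//.
  by apply: le_mean_cst => // z; rewrite addr_ge0// sqr_ge0.
have IA : \int[eqm]_z (A.[X z] ^+ 2) <= I.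
  by apply: le_mean => // z; rewrite lerDl sqr_ge0.
have Acp : \int[eqm]_z (A.[X z] ^+ 2) = \int[unif]_t (A.[cp t] ^+ 2).
  have h (q : {poly R}) (x : R) : q.[x] ^+ 2 = (q ^+ 2).[x] by rewrite horner_exp.
  under eq_Rintegral do rewrite h.
  under [RHS]eq_Rintegral do rewrite h.
  apply: (minimizer_mean_poly g08 Vrec V0 Vlim bX (EN := V 0)) => //.
    exact: coordK_Kreal.
  move=> e e0 _; rewrite -lee_fin -(log_energy_equilibrium g08 Vrec V0 Vlim).
  exact: reg_mutual_le_log_energy.
have sA : (size A <= n.+1)%N by rewrite -sp; exact: size_poly.
have An : A`_n = 1.
  rewrite coef_poly sp ltnSn (_ : p`_n = 1)//.
  by move: pm; rewrite /lead_coef sp.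
have := mean_sqr_ge g08 Vrec V8 0 n0 (erefl _) sA.
rewrite An expr1n mul1r add0n -Acp => h.
rewrite L2E /=; set y := _ * _.
have y0 : 0 <= y by rewrite mulr_ge0 ?exprn_ge0 ?divr_ge0 ?expR_ge0.
rewrite -[leLHS](ger0_norm y0) -sqrtr_sqr ler_sqrt; last first.
  by apply: le_trans IA; apply: le_trans h; rewrite !mulr_ge0 ?expR_ge0// invr_ge0.
apply: le_trans IA; apply: le_trans h.
rewrite /y exprMn exprMn.
have -> : (expR (- V 0) ^+ n) ^+ 2 = expR (- (2 * n%:R * V 0)).
  by rewrite -exprM -expRM_natr natrM; congr expR; ring.
rewrite ler_wpM2l ?expR_ge0//.
have -> : expR (2 * V (trunc_log 2 n)) = expR (V (trunc_log 2 n)) ^+ 2.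
  by rewrite -expRM_natl.
have := sqr_ge0 (expR (V (trunc_log 2 n))); move: (expR _ ^+ 2) => w; lra.
Qed.

(** The orthogonal polynomial is monic of degree n by construction, so the bound for all
    monic polynomials applies to it directly. *)
Lemma W2_ge n : (0 < n)%N -> expR (V (trunc_log 2 n)) / 8 <= W2 eqm n.
Proof.
move=> n0; rewrite /W2 [X in _ / X ^+ _]Cap_supp.
rewrite ler_pdivlMr ?exprn_gt0 ?expR_gt0// mulrC; apply: L2norm_ge => //.
rewrite /monic_orthogonal; case: xgetP => [Q _ [//]|_].
by split; [exact: monicXn | rewrite size_polyXn].
Qed.

End WidomLowerBound.

(** * The choice of the parameters *)

Section GrowthChoice.
Variables (R : realType) (c : nat -> R).
Hypothesis hc : forall n : nat, (1 <= n)%N -> 1 <= c n.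
Let u n : R := ln (c n) / n%:R.
Hypothesis hsub : u @ \oo --> (0 : R).

Let u_ge0 n : 0 <= u n.
Proof.
case: n => [|n]; first by rewrite /u invr0 mulr0.
by rewrite divr_ge0// ln_ge0// hc.
Qed.

Let cvg_u : cvgn u. Proof. by apply/cvg_ex; exists 0. Qed.

Let le_sups n m : (n <= m)%N -> u m <= sups u n.
Proof.
move=> nm; apply: ub_le_sup; last by exists m.
apply: has_ubound_sdrop; exact/bounded_fun_has_ubound/cvg_seq_bounded.
Qed.

Let sups_le n m : (n <= m)%N -> sups u m <= sups u n.
Proof.
move=> nm; have := @nonincreasing_sups R u; apply => //.
exact/bounded_fun_has_ubound/cvg_seq_bounded.
Qed.

Lemma growth_potentials : exists V : nat -> R,
  [/\ forall s, ln 8 <= 2 * V s - V s.+1, forall s, ln 8 <= V s,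
      forall eps : R, 0 < eps -> exists m, (V m + 1) * (1 / 2) ^+ m < eps
    & forall n, (1 <= n)%N -> c n <= expR (V (trunc_log 2 n)) / 8].
Proof.
have sups0 n : 0 <= sups u n by exact: le_trans (u_ge0 n) (le_sups (leqnn n)).
have l8 : 0 <= ln 8 :> R by apply: ln_ge0; lra.
exists (fun s => 2 ^+ s * (2 * sups u (2 ^ s)%N) + ln 8); split.
- move=> s; have : sups u (2 ^ s.+1)%N <= sups u (2 ^ s)%N by apply: sups_le; rewrite leq_exp2l.
  move=> h; have : 2 ^+ s * sups u (2 ^ s.+1)%N <= 2 ^+ s * sups u (2 ^ s)%N by rewrite ler_wpM2l.
  by rewrite [2 ^+ s.+1]exprS; lra.
- by move=> s; rewrite lerDr mulr_ge0// mulr_ge0.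
- move=> eps e0.
  have e4 : 0 < eps / 4 by rewrite divr_gt0.
  have /cvgrPdist_lt/(_ _ e4)[N1 _ H1] := cvg_sups hsub.
  have q0 : 0 <= 1 / 2 :> R by lra.
  have q1 : 1 / 2 < 1 :> R by lra.
  have e2 : 0 < eps / 2 by rewrite divr_gt0.
  have [N2 H2] := geometric_lt (ln 8 + 1) q0 q1 e2.
  exists (maxn N1 N2); set m := maxn _ _.
  have h1 : sups u (2 ^ m)%N < eps / 4.
    have := H1 (2 ^ m)%N _; rewrite /= sub0r normrN => h.
    apply: le_lt_trans (ler_norm _) (h _).
    by rewrite (leq_trans (leq_maxl N1 N2))// ltnW// ltn_expl.
  have h2 : (ln 8 + 1 : R) * (1 / 2) ^+ m <= (ln 8 + 1) * (1 / 2) ^+ N2.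
    apply: ler_wpM2l; first by rewrite addr_ge0.
    by apply: ler_wiXn2l; [|exact: ltW|exact: leq_maxr].
  have -> : (2 ^+ m * (2 * sups u (2 ^ m)%N) + ln 8 + 1) * (1 / 2) ^+ m =
     (2 ^+ m * (1 / 2) ^+ m) * (2 * sups u (2 ^ m)%N) + (ln 8 + 1) * (1 / 2) ^+ m by ring.
  have -> : 2 ^+ m * (1 / 2) ^+ m = 1 :> R by rewrite -exprMn mul1r divff// expr1n.
  rewrite (mul1r (2 * _)); lra.
- move=> n n1; set j := trunc_log 2 n.
  have j1 : (2 ^ j <= n)%N by exact: trunc_logP.
  have j2 : (n < 2 ^ j.+1)%N by exact: trunc_log_ltn.
  have c0 : 0 < c n by apply: lt_le_trans (hc n1).
  rewrite expRD [expR (ln 8)]lnK ?posrE// -mulrA divff// mulr1.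
  rewrite -[leLHS]lnK ?posrE// ler_expR.
  have -> : ln (c n) = n%:R * u n by rewrite /u mulrCA divff ?mulr1// pnatr_eq0 -lt0n.
  rewrite mulrA -exprSr; apply: ler_pM => //; last exact: le_sups.
  by rewrite -natrX ler_nat ltnW.
Qed.

End GrowthChoice.

Unset Implicit Arguments.

Theorem theorem2p2 (R : realType) (c : nat -> R)
    (hc : forall n : nat, (1 <= n)%N -> 1 <= c n)
    (hsub : (fun n : nat => ln (c n) / n%:R) @ \oo --> (0 : R)) :
  exists gamma : nat -> R,
    [/\ forall s : nat, (1 <= s)%N -> 0 < gamma s < 1 / 4,
        0 < Cap (Kset gamma)
      & forall n : nat, (1 <= n)%N ->
          c n <= W2 (equilibrium_measure (Kset gamma)) n].
Proof.
have [V [Vstep V8 Vlim cV]] := growth_potentials hc hsub.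
pose gamma s := expR (V s - 2 * V s.-1).
have e8 : expR (- ln 8) = 1 / 8 :> R by rewrite expRN lnK ?posrE// div1r.
have g08 s : 0 < shift_seq gamma s <= 1 / 8.
  rewrite /shift_seq /gamma/= expR_gt0 -e8 ler_expR.
  by have := Vstep s; lra.
have Vrec s : 2 * V s = - ln (shift_seq gamma s) + V s.+1.
  by rewrite /shift_seq /gamma/= expRK; ring.
exists gamma; split.
- move=> [//|s] _; have /andP[h1 h2] := g08 s; rewrite /shift_seq in h1 h2.
  by apply/andP; split; lra.
- by rewrite (Cap_Kset g08 Vrec V8 Vlim) expR_gt0.
- move=> n n1; apply: le_trans (cV n n1) _.
  exact: (W2_ge g08 Vrec V8 Vlim).
Qed.
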